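(* Codistinguished varieties intersect $\mathbb{T}^2$ along smooth curves. That is, for any codistinguished variety $\mathcal{Z}_r$, the set $\mathcal{Z}_r\cap\mathbb{T}^2$ consists of smooth components: near each of its points, $\mathcal{Z}_r\cap\mathbb{T}^2$ is a finite union of smooth curves in $\mathbb{T}^2$, each parametrized by analytic functions.
   Context: $\mathbb{D}$ is the open unit disk and $\mathbb{T}$ the unit circle. For a polynomial $r\in\mathbb{C}[z_1,z_2]$ of bidegree $(m,n)$, its reflection is $\tilde r(z_1,z_2)=z_1^mz_2^n\overline{r(1/\bar z_1,1/\bar z_2)}$, and $r$ is essentially $\mathbb{T}^2$-symmetric if $\tilde r=\lambda r$ for some unimodular constant $\lambda$. A codistinguished variety is a zero set $\mathcal{Z}_r=\{z\in\mathbb{C}^2:r(z)=0\}$ of an essentially $\mathbb{T}^2$-symmetric polynomial $r\in\mathbb{C}[z_1,z_2]$ that does not vanish in the bidisk $\mathbb{D}^2$. *)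

(* Defs.v *)
From HB Require Import structures.
From mathcomp Require Import all_boot all_order all_algebra.
From mathcomp Require Import complex polyXY.
From mathcomp Require Import all_classical all_reals all_analysis.

Set Implicit Arguments.
Unset Strict Implicit.
Unset Printing Implicit Defensive.

Import Order.TTheory GRing.Theory Num.Theory.
Import numFieldNormedType.Exports.

Local Open Scope classical_set_scope.
Local Open Scope ring_scope.

(* The alias [R[i]^o] is what carries the norm topology of [R[i]]. *)
Notation C2 R := ((R[i]^o * R[i]^o)%type).

(* A polynomial r in C[z1, z2] is [r : {poly {poly R[i]}}]: r`_j`_k is the
   coefficient of z1^j z2^k and [r.[z1, z2]] the value at (z1, z2). *)
Section Codistinguished.
Variable R : realType.
Implicit Type r : {poly {poly R[i]}}.

Definition bidegree r : nat * nat := ((size r).-1, (sizeY r).-1).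

(* Coefficientwise form of z1^m z2^n conj(r(1/conj z1, 1/conj z2)), with (m, n)
   the bidegree of r; see [horner_reflection]. *)
Definition reflection r : {poly {poly R[i]}} :=
  let: (m, n) := bidegree r in
  \poly_(j < m.+1) \poly_(k < n.+1) (r`_(m - j)`_(n - k))^*.

Definition essentially_T2_symmetric r : Prop :=
  exists2 lambda : R[i], `|lambda| = 1 & reflection r = lambda%:P *: r.

Definition zero_set r : set (C2 R) := [set z | r.[z.1, z.2] = 0].

Definition bidisk : set (C2 R) := [set z | `|z.1| < 1 /\ `|z.2| < 1].

Definition torus : set (C2 R) := [set z | `|z.1| = 1 /\ `|z.2| = 1].

Definition codistinguished_variety (V : set (C2 R)) : Prop :=
  exists r, [/\ essentially_T2_symmetric r,
                zero_set r `&` bidisk = set0 &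
                V = zero_set r].

Lemma horner_reflection r (z1 z2 : R[i]) : z1 != 0 -> z2 != 0 ->
  (reflection r).[z1, z2] =
  z1 ^+ (bidegree r).1 * z2 ^+ (bidegree r).2 * (r.[(z1^*)^-1, (z2^*)^-1])^*.
Proof.
move=> z1N0 z2N0; rewrite /reflection /bidegree /=.
set m := (size r).-1; set n := (sizeY r).-1.
have szr : (size r <= m.+1)%N by rewrite /m; case: (size r).
have szrY j : (size (r`_j)%R <= n.+1)%N.
  have [ltj|lej] := ltnP j (size r); last by rewrite nth_default // size_poly0.
  apply: leq_trans (_ : sizeY r <= _)%N; last by rewrite /n; case: (sizeY r).
  exact: (leq_bigmax (F := fun i : 'I_(size r) => size (r`_i)%R) (Ordinal ltj)).
rewrite (horner_coef_wide _ szr) horner_poly !horner_sum rmorph_sum mulr_sumr.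
rewrite (reindex_inj rev_ord_inj) /=; apply: eq_bigr => j _.
have lejm : (j <= m)%N by rewrite -ltnS.
rewrite subSS subKn // !hornerM -!polyC_exp !hornerC horner_poly.
rewrite (horner_coef_wide _ (szrY j)) rmorphM rmorph_sum /= !rmorphXn /=.
rewrite fmorphV /= conjCK !mulr_suml mulr_sumr.
rewrite (reindex_inj rev_ord_inj) /=; apply: eq_bigr => k _.
have lekn : (k <= n)%N by rewrite -ltnS.
rewrite subSS subKn // rmorphM rmorphXn /= fmorphV /= conjCK.
have -> : z1 ^+ m = z1 ^+ (m - j) * z1 ^+ j by rewrite -exprD subnK.
have -> : z2 ^+ n = z2 ^+ (n - k) * z2 ^+ k by rewrite -exprD subnK.
rewrite !exprVn; move: (_^*) => c.
rewrite -[c / _ / _]mulrA -invfM [z2 ^+ k * z1 ^+ j]mulrC.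
rewrite [X in _ = X * _]mulrACA [RHS]mulrACA.
by rewrite divff ?mulf_neq0 ?expf_neq0 // mulr1 mulrC [c * _]mulrC mulrA.
Qed.

Definition real_analytic_at (f : R -> R) (t : R) : Prop :=
  exists a : R^nat, \forall s \near t, pseries a (s - t) @ \oo --> f s.

Definition analytic_at (f : R -> R[i]) (t : R) : Prop :=
  real_analytic_at (fun s => complex.Re (f s)) t /\
  real_analytic_at (fun s => complex.Im (f s)) t.

Definition cderive1 (f : R -> R[i]) (t : R) : R[i] :=
  Complex (derive1 (fun s => complex.Re (f s)) t)
          (derive1 (fun s => complex.Im (f s)) t).

(* A smooth curve in the torus through p with an analytic parametrization:
   gamma is analytic and regular on ]-e, e[, gamma 0 = p, and gamma is a
   homeomorphism onto its image (with inverse g), so that the image has neither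
   self-crossings nor an end that accumulates on the curve itself. *)
Definition smooth_analytic_curve (p : C2 R) (S : set (C2 R)) : Prop :=
  exists (e : R) (gamma : R -> C2 R) (g : C2 R -> R),
    [/\ 0 < e, gamma 0 = p,
        S = gamma @` [set t | `|t| < e] &
        S `<=` torus] /\
    [/\ forall t, `|t| < e ->
          analytic_at (fun s => (gamma s).1) t /\
          analytic_at (fun s => (gamma s).2) t,
        forall t, `|t| < e ->
          cderive1 (fun s => (gamma s).1) t != 0 \/
          cderive1 (fun s => (gamma s).2) t != 0,
        forall t, `|t| < e -> g (gamma t) = t &
        {within S, continuous g}].

End Codistinguished.

(* Main.v *)
Require Import Defs.
From HB Require Import structures.
From mathcomp Require Import all_boot all_order all_algebra.
From mathcomp Require Import complex polyXY separable.
From mathcomp Require Import ring lra.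
From mathcomp Require Import all_classical all_reals all_analysis.

Set Implicit Arguments.
Unset Strict Implicit.
Unset Printing Implicit Defensive.

Import Order.TTheory GRing.Theory Num.Theory.
Import numFieldNormedType.Exports.

Local Open Scope classical_set_scope.
Local Open Scope ring_scope.

(* Near p = (p1, p2) write z1 = p1 (1 + ix)/(1 - ix) with x real and z2 = p2 + w, so
   that the variety becomes the zero set of a polynomial Q(x, w). If |z1| = 1 and
   r(z1, -) <> 0, all roots of r(z1, -) are unimodular: a root inside the disk would
   persist inside the bidisk, and a root outside it is reflected to one inside. So for
   small real x <> 0 the small roots of Q(x, -) lie on a circle. By Rellich's argument
   this forbids fractional Puiseux exponents: all small roots satisfy w = O(x), so
   Q(x, x w) = x^n Q1(x, w) with Q1(0, -) of degree exactly n. For Q squarefree, with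
   A Q + B Q_w = D(x) <> 0, each such blow-up divides D by x^(n-1), so that finitely
   many blow-ups lead to simple roots, which are analytic in x. A factor of Q that is
   a power of x contributes the curve {p1} x T. *)

(** The circle condition is not itself stable under blow-up: after w = x (c + w') it bears on p2 + x
    (c + w'). The induction therefore runs over the wider condition |C(x) + x^k w| = 1 with C(0) <>
    0, which the substitution reproduces with k + 1 and C + c x^(k+1). Rellich's argument needs no
    more than this. Seen at a small scale, the circle becomes its tangent line, so the limit roots
    along a Newton edge lie on one line. On an edge of slope below 1 they sum to 0, and the sum of
    their squares, in suitable coordinates, is proportional to the sign of x, yet nonpositive for
    both signs; hence all limit roots vanish, which no genuine edge allows. The conditions are
    imposed for x <> 0 only: at x = 0 the slice of r may vanish identically, and the squarefree part
    has the same roots as Q only off finitely many x. The analysis rests on coefficient bounds: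
    roots move continuously because a polynomial without small roots has its coefficients controlled
    by its value at 0, and power series arise as limits of polynomials in a weighted l1 norm. *)

Local Notation "x %:C" := (real_complex _ x) (format "x %:C") : ring_scope.

(* The bivariate polynomials [Q] below have outer variable w and coefficients in
   C[x]; [spec x Q] is Q(x, -). *)
Local Notation spec x := (map_poly (horner_eval x)).

(** * Complex moduli and a weighted norm on polynomials *)

Section ComplexModulus.
Variable R : realType.
Implicit Types x y z : R[i].

(** The norm of [R[i]] takes its values in [R[i]]; the real part moves estimates to the ordered
    field [R]. *)
Definition cabs z : R := complex.Re `|z|.

Lemma normcE_cabs z : `|z| = (cabs z)%:C.
Proof. by rewrite /cabs RRe_real ?normr_real. Qed.

Lemma cabs_ge0 z : 0 <= cabs z.
Proof. by rewrite -ler0c -normcE_cabs normr_ge0. Qed.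

Lemma cabs_eq0 z : (cabs z == 0) = (z == 0).
Proof. by rewrite -(inj_eq (@complexI R)) -normcE_cabs normr_eq0. Qed.

Lemma cabs0 : cabs 0 = 0. Proof. by apply/eqP; rewrite cabs_eq0. Qed.

Lemma cabs1 : cabs 1 = 1. Proof. by rewrite /cabs normr1. Qed.

Lemma cabs_gt0 z : (0 < cabs z) = (z != 0).
Proof. by rewrite lt_def cabs_eq0 cabs_ge0 andbT. Qed.

Lemma cabsM x y : cabs (x * y) = cabs x * cabs y.
Proof. by apply: complexI; rewrite rmorphM /= -!normcE_cabs normrM. Qed.

Lemma cabsX x n : cabs (x ^+ n) = cabs x ^+ n.
Proof. by apply: complexI; rewrite rmorphXn /= -!normcE_cabs normrX. Qed.

Lemma cabsV x : cabs x^-1 = (cabs x)^-1.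
Proof. by apply: complexI; rewrite fmorphV /= -!normcE_cabs normfV. Qed.

Lemma cabsN x : cabs (- x) = cabs x.
Proof. by rewrite /cabs normrN. Qed.

Lemma cabs_distC x y : cabs (x - y) = cabs (y - x).
Proof. by rewrite /cabs distrC. Qed.

Lemma cabsD x y : cabs (x + y) <= cabs x + cabs y.
Proof. by rewrite -lecR rmorphD /= -!normcE_cabs ler_normD. Qed.

Lemma cabsB x y : cabs (x - y) <= cabs x + cabs y.
Proof. by rewrite (le_trans (cabsD _ _)) // cabsN. Qed.

Lemma cabs_sum (I : Type) (r : seq I) (P : pred I) (F : I -> R[i]) :
  cabs (\sum_(i <- r | P i) F i) <= \sum_(i <- r | P i) cabs (F i).
Proof.
elim/big_rec2: _ => [|i a b _ le_ab]; first by rewrite cabs0.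
by rewrite (le_trans (cabsD _ _)) // lerD2l.
Qed.

Lemma cabs_real (a : R) : cabs a%:C = `|a|.
Proof. by rewrite /cabs normc_def /= expr0n addr0 sqrtr_sqr. Qed.

Lemma sqr_cabs z : cabs z ^+ 2 = complex.Re z ^+ 2 + complex.Im z ^+ 2.
Proof. by rewrite /cabs normc_def /= sqr_sqrtr // addr_ge0 ?sqr_ge0. Qed.

Lemma normr_Re_le z : `|complex.Re z| <= cabs z.
Proof.
rewrite -(ler_pXn2r (ltn0Sn 1)) ?nnegrE ?cabs_ge0 // sqr_cabs real_normK ?num_real //.
by rewrite lerDl sqr_ge0.
Qed.

Lemma normr_Im_le z : `|complex.Im z| <= cabs z.
Proof.
rewrite -(ler_pXn2r (ltn0Sn 1)) ?nnegrE ?cabs_ge0 // sqr_cabs real_normK ?num_real //.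
by rewrite lerDr sqr_ge0.
Qed.

Lemma cabs_le_ReIm z : cabs z <= `|complex.Re z| + `|complex.Im z|.
Proof.
rewrite -(ler_pXn2r (ltn0Sn 1)) ?nnegrE ?cabs_ge0 ?addr_ge0 // sqr_cabs.
rewrite sqrrD !real_normK ?num_real // lerD2r lerDl.
by rewrite mulrn_wge0 // mulr_ge0.
Qed.

End ComplexModulus.

Section PolynomialNorm.
Variable R : realType.
Implicit Types (p q : {poly R[i]}) (rho : R).

Definition abs_poly p : {poly R} := \poly_(i < size p) cabs p`_i.

Lemma coef_abs_poly p i : (abs_poly p)`_i = cabs p`_i.
Proof.
rewrite coef_poly; case: ltnP => // /(nth_default 0) ->.
by rewrite cabs0.
Qed.

(** This is the l1 norm of the coefficients with weights rho^i. As a value of a majorant polynomial,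
    it inherits its inequalities from coefficientwise comparison. *)
Definition pnorm rho p : R := (abs_poly p).[rho].

Lemma horner_le_coef (P Q : {poly R}) rho : 0 <= rho ->
  (forall i, P`_i <= Q`_i) -> P.[rho] <= Q.[rho].
Proof.
move=> rho0 lePQ; pose n := maxn (size P) (size Q).
rewrite (horner_coef_wide _ (leq_maxl _ _ : (_ <= n)%N)).
rewrite (horner_coef_wide _ (leq_maxr _ _ : (_ <= n)%N)).
by apply: ler_sum => i _; rewrite ler_wpM2r ?exprn_ge0.
Qed.

Lemma pnorm_ge0 rho p : 0 <= rho -> 0 <= pnorm rho p.
Proof.
move=> rho0; rewrite /pnorm -[leLHS](horner0 rho).
by apply: horner_le_coef => // i; rewrite coef0 coef_abs_poly cabs_ge0.
Qed.

Lemma pnorm_coef rho p i : 0 <= rho -> cabs p`_i * rho ^+ i <= pnorm rho p.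
Proof.
move=> rho0.
have -> : cabs p`_i * rho ^+ i = (cabs p`_i *: 'X^i).[rho].
  by rewrite hornerZ hornerXn.
apply: horner_le_coef => // j; rewrite coefZ coefXn coef_abs_poly.
by case: eqP => [->|_]; rewrite ?mulr1 // mulr0 cabs_ge0.
Qed.

Lemma pnormD rho p q : 0 <= rho -> pnorm rho (p + q) <= pnorm rho p + pnorm rho q.
Proof.
move=> rho0; rewrite /pnorm -hornerD; apply: horner_le_coef => // i.
by rewrite coefD !coef_abs_poly coefD cabsD.
Qed.

Lemma pnormN rho p : pnorm rho (- p) = pnorm rho p.
Proof.
congr (_.[_]); apply/polyP => i.
by rewrite !coef_abs_poly coefN cabsN.
Qed.

Lemma pnormM rho p q : 0 <= rho -> pnorm rho (p * q) <= pnorm rho p * pnorm rho q.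
Proof.
move=> rho0; rewrite /pnorm -hornerM; apply: horner_le_coef => // i.
rewrite coef_abs_poly !coefM (le_trans (cabs_sum _ _ _)) // ler_sum // => j _.
by rewrite cabsM !coef_abs_poly.
Qed.

Lemma pnorm_sum rho (I : Type) (r : seq I) (F : I -> {poly R[i]}) : 0 <= rho ->
  pnorm rho (\sum_(i <- r) F i) <= \sum_(i <- r) pnorm rho (F i).
Proof.
move=> rho0; elim/big_rec2: _ => [|i a b _ le_ab].
  by rewrite /pnorm /abs_poly size_poly0 horner_poly big_ord0.
by rewrite (le_trans (pnormD _ _ rho0)) // lerD2l.
Qed.

Lemma pnormC rho (c : R[i]) : pnorm rho c%:P = cabs c.
Proof.
rewrite /pnorm (_ : abs_poly _ = (cabs c)%:P) ?hornerC //.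
apply/polyP => i; rewrite coef_abs_poly !coefC.
by case: (i == 0)%N; rewrite ?cabs0.
Qed.

Lemma pnormX rho p n : 0 <= rho -> pnorm rho (p ^+ n) <= pnorm rho p ^+ n.
Proof.
move=> rho0; elim: n => [|n IHn]; first by rewrite !expr0 pnormC cabs1.
by rewrite !exprS (le_trans (pnormM _ _ rho0)) // ler_wpM2l ?pnorm_ge0.
Qed.

Lemma pnorm_horner rho p (x : R[i]) : cabs x <= rho -> cabs p.[x] <= pnorm rho p.
Proof.
move=> lexr; rewrite /pnorm /abs_poly horner_poly horner_coef.
rewrite (le_trans (cabs_sum _ _ _)) // ler_sum // => i _.
by rewrite cabsM cabsX ler_wpM2l ?cabs_ge0 // lerXn2r ?nnegrE ?cabs_ge0 // (le_trans (cabs_ge0 x)).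
Qed.

Lemma pnorm_le rho rho' p : 0 <= rho -> rho <= rho' -> pnorm rho p <= pnorm rho' p.
Proof.
move=> rho0 le_rho; rewrite /pnorm !horner_poly ler_sum // => i _.
by rewrite ler_wpM2l ?cabs_ge0 // lerXn2r ?nnegrE // (le_trans rho0).
Qed.

(** The quotient of p - p(x0) by X - x0 is bounded on the unit disk around x0 by its norm at radius
    1 + |x0|. *)
Lemma horner_lipschitz_at p (x0 : R[i]) :
  exists2 K : R, 0 < K & forall x, cabs (x - x0) <= 1 ->
    cabs (p.[x] - p.[x0]) <= K * cabs (x - x0).
Proof.
have /factor_theorem [q pE] : root (p - p.[x0]%:P) x0.
  by rewrite rootE !hornerE subrr.
pose K := pnorm (1 + cabs x0) q.
have K0 : 0 <= K by rewrite pnorm_ge0 // addr_ge0 ?cabs_ge0.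
exists (K + 1) => [|x lex]; first by rewrite ltr_wpDl.
have -> : p.[x] - p.[x0] = q.[x] * (x - x0).
  by have := congr1 (horner^~ x) pE; rewrite /= !hornerE.
rewrite cabsM ler_wpM2r ?cabs_ge0 // (@le_trans _ _ K) ?lerDl //.
by apply: pnorm_horner; rewrite -[x](subrK x0) (le_trans (cabsD _ _)) // lerD2r.
Qed.

Lemma horner_continuous_at p (x0 : R[i]) (e : R) : 0 < e ->
  exists2 d : R, 0 < d & forall x, cabs (x - x0) < d -> cabs (p.[x] - p.[x0]) < e.
Proof.
move=> e0; have [K K0 lipK] := horner_lipschitz_at p x0.
exists (Num.min 1 (e / K)) => [|x]; first by rewrite lt_min ltr01 divr_gt0.
rewrite lt_min => /andP[lt1 lte].
by rewrite (le_lt_trans (lipK _ (ltW lt1))) // mulrC -ltr_pdivlMr.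
Qed.

(* Normalising p(0) = 1, p is a product of factors 1 - y/z with |z| >= d. *)
Lemma pnorm_rootfree p (d : R) : 0 < d ->
  (forall z, cabs z < d -> p.[z] != 0) ->
  pnorm 1 p <= cabs p.[0] * (1 + d^-1) ^+ (size p).-1.
Proof.
move=> d0 rootfree.
have p0 : p != 0.
  by apply: contraNneq (rootfree 0 _) => [->|]; rewrite ?hornerC ?cabs0.
have [rs pE] := closed_field_poly_normal p.
have szrs : (size p).-1 = size rs.
  by rewrite pE size_scale ?lead_coef_eq0 // size_prod_XsubC.
have lers z : z \in rs -> d <= cabs z.
  move=> zrs; rewrite leNgt; apply/negP => /rootfree/negP; apply.
  by rewrite pE hornerZ mulf_eq0 -rootE root_prod_XsubC zrs orbT.
rewrite szrs pE -mul_polyC hornerM hornerC cabsM.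
rewrite (le_trans (pnormM _ _ ler01)) // pnormC -mulrA ler_wpM2l ?cabs_ge0 //.
elim: rs lers {pE szrs} => [|z rs IHrs] lers.
  by rewrite !big_nil expr0 pnormC hornerC cabs1 mulr1.
rewrite !big_cons hornerM cabsM exprS mulrACA (le_trans (pnormM _ _ ler01)) //.
rewrite ler_pM ?pnorm_ge0 //; last first.
  by apply: IHrs => y yrs; rewrite lers // inE yrs orbT.
(* The factor ['X - z%:P] has norm 1 + |z| and modulus |z| at 0, with 1 <= |z| / d. *)
have led : d <= cabs z by rewrite lers // mem_head.
rewrite !hornerE cabsN mulrDr mulr1 (le_trans (pnormD _ _ ler01)) //.
rewrite pnormN pnormC addrC lerD2l.
have -> : pnorm 1 'X = 1.
  rewrite /pnorm (_ : abs_poly 'X = 'X) ?hornerX //.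
  by apply/polyP => i; rewrite coef_abs_poly !coefX; case: eqP; rewrite ?cabs1 ?cabs0.
by rewrite ler_pdivlMr ?mul1r.
Qed.

End PolynomialNorm.

(** * Specialization of the parameter and continuity of roots *)

Section Specialization.
Variable R : realType.
Implicit Types (Q : {poly {poly R[i]}}) (x y : R[i]).

Lemma coef_spec x Q i : (spec x Q)`_i = (Q`_i).[x].
Proof. by rewrite coef_map. Qed.

Lemma spec_comp x Q P : spec x (Q \Po P) = spec x Q \Po spec x P.
Proof. exact: map_comp_poly. Qed.

Lemma specC x (p : {poly R[i]}) : spec x p%:P = p.[x]%:P.
Proof. exact: map_polyC. Qed.

Lemma specX x : spec x 'X = 'X.
Proof. exact: map_polyX. Qed.

Lemma spec_deriv x Q : spec x Q^`() = (spec x Q)^`().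
Proof. by rewrite deriv_map. Qed.

Lemma horner_spec x Q y : (spec x Q).[y] = Q.[y%:P].[x].
Proof. by have := horner_map (horner_eval x) Q y%:P; rewrite /= !horner_evalE hornerC. Qed.

Lemma size_spec x Q : (size (spec x Q) <= size Q)%N.
Proof. exact: size_poly. Qed.

(** Without a root within e of y0, [pnorm_rootfree] bounds every coefficient of the recentred
    polynomial by a constant times its value at 0. Near x0 that value is arbitrarily small, while a
    coefficient that is nonzero at x0 stays bounded below. *)
Lemma root_continuity Q x0 y0 : spec x0 Q != 0 -> (spec x0 Q).[y0] = 0 ->
  forall e : R, 0 < e -> exists2 d : R, 0 < d & forall x, cabs (x - x0) < d ->
    exists2 y, cabs (y - y0) < e & (spec x Q).[y] = 0.
Proof.
move=> Q0 Qy0 e e0; pose P := Q \Po ('X + y0%:P%:P).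
have specP x : spec x P = spec x Q \Po ('X + y0%:P).
  by rewrite spec_comp rmorphD /= specX specC hornerC.
have : spec x0 P != 0.
  by rewrite specP comp_poly2_eq0 ?size_XaddC.
move=> P0.
have [k Pk0] : exists k, (P`_k).[x0] != 0.
  exists (size (spec x0 P)).-1.
  by rewrite -horner_evalE -coef_map -lead_coefE lead_coef_eq0.
pose a := cabs (P`_k).[x0]; have a0 : 0 < a by rewrite cabs_gt0.
pose K : R := (1 + e^-1) ^+ size P.
have K0 : 0 < K by rewrite exprn_gt0 // addr_gt0 ?invr_gt0.
have P00 : (P`_0).[x0] = 0.
  by rewrite -horner_evalE -coef_map -horner_coef0 specP horner_comp !hornerE.
have [d1 d10 cont1] := horner_continuous_at P`_k x0 (divr_gt0 a0 (ltr0Sn _ 1)).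
have [d2 d20 cont2] :=
  horner_continuous_at (P`_0) x0 (divr_gt0 a0 (mulr_gt0 (ltr0Sn _ 1) K0)).
exists (Num.min d1 d2) => [|x]; first by rewrite lt_min d10.
rewrite lt_min => /andP[/cont1 ltk /cont2 lt0].
have [//|norootP] := pselect (exists2 y, cabs (y - y0) < e & (spec x Q).[y] = 0).
exfalso; have rootfree z : cabs z < e -> (spec x P).[z] != 0.
  move=> ltz; apply: contra_notN norootP => /eqP Pz; exists (z + y0).
    by rewrite addrK.
  by move: Pz; rewrite specP horner_comp !hornerE.
have := le_trans (pnorm_coef _ k ler01) (pnorm_rootfree e0 rootfree).
rewrite expr1n mulr1 horner_coef0 !coef_spec.
apply/negP; rewrite -ltNge.
rewrite P00 subr0 in lt0.
apply: (@lt_trans _ _ (a / 2)).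
  apply: (@le_lt_trans _ _ (cabs (P`_0).[x] * K)).
    rewrite ler_wpM2l ?cabs_ge0 // ler_weXn2l ?lerDl ?invr_ge0 ?(ltW e0) //.
    exact: leq_trans (leq_pred _) (size_spec _ _).
  by rewrite -ltr_pdivlMr // -mulrA -invfM.
have := cabsB (P`_k).[x] ((P`_k).[x] - (P`_k).[x0]).
by rewrite opprB addrC subrK -/a; move: ltk; lra.
Qed.

End Specialization.

(** * Simple roots are analytic *)

Definition ccontinuous_at (R : realType) (f : R -> R[i]) (t : R) : Prop :=
  forall e : R, 0 < e -> exists2 d : R, 0 < d &
    forall s, `|s - t| < d -> cabs (f s - f t) < e.

Lemma near_normP (R : realType) (t : R) (P : R -> Prop) :
  (\forall s \near t, P s) <->
  exists2 d : R, 0 < d & forall s, `|s - t| < d -> P s.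
Proof.
split=> [/nbhs_ballP[d /= d0 dP]|[d d0 dP]].
  by exists d => // s lts; apply: dP; rewrite /ball /= distrC.
by apply/nbhs_ballP; exists d => // s; rewrite /ball /= distrC; apply: dP.
Qed.

Lemma ReD (R : realType) (y z : R[i]) :
  complex.Re (y + z) = complex.Re y + complex.Re z.
Proof. by case: y z => ? ? []. Qed.

Lemma ImD (R : realType) (y z : R[i]) :
  complex.Im (y + z) = complex.Im y + complex.Im z.
Proof. by case: y z => ? ? []. Qed.

Lemma ReB (R : realType) (y z : R[i]) :
  complex.Re (y - z) = complex.Re y - complex.Re z.
Proof. by case: y z => ? ? []. Qed.

Lemma ImB (R : realType) (y z : R[i]) :
  complex.Im (y - z) = complex.Im y - complex.Im z.
Proof. by case: y z => ? ? []. Qed.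

Definition ReImD := (ReD, ImD).

Lemma real_analytic_at_near (R : realType) (f g : R -> R) t :
  (\forall s \near t, f s = g s) -> real_analytic_at g t -> real_analytic_at f t.
Proof.
move=> eqfg [a Ha]; exists a.
by apply: filterS2 eqfg Ha => s ->.
Qed.

Lemma real_analytic_at_addl (R : realType) (c : R) (f : R -> R) t :
  real_analytic_at f t -> real_analytic_at (fun s => c + f s) t.
Proof.
move=> [a Ha]; exists (fun i => a i + (i == 0)%N%:R * c).
apply: filterS Ha => s; move: (s - t) (f s) => x l cva.
rewrite -(cvg_shiftS (pseries _ x)) /=.
have -> : (fun n => pseries (fun i => a i + (i == 0)%N%:R * c) x n.+1) =
          (fun n => c + pseries a x n.+1).
  apply/funext => n; rewrite /pseries /series /= !big_nat_recl //=.
  rewrite expr0 !mulr1 mul1r addrA [c + _]addrC; congr (_ + _).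
  by apply: eq_bigr => i _; rewrite mul0r addr0.
by apply: cvgD; [exact: cvg_cst | rewrite (cvg_shiftS (pseries a x))].
Qed.

Lemma real_analytic_at_mulX (R : realType) (f : R -> R) :
  real_analytic_at f 0 -> real_analytic_at (fun s => s * f s) 0.
Proof.
move=> [a Ha]; exists (fun i => if i is j.+1 then a j else 0).
apply: filterS Ha => s; rewrite subr0 => cva.
rewrite -(cvg_shiftS (pseries _ s)) /=.
have -> : (fun n => pseries (fun i => if i is j.+1 then a j else 0) s n.+1) =
          (fun n => s * pseries a s n).
  apply/funext => n; rewrite /pseries /series /= !big_nat_recl //=.
  rewrite mul0r add0r mulr_sumr.
  by apply: eq_bigr => i _; rewrite exprS mulrCA.
by apply: cvgM => //; exact: cvg_cst.
Qed.

Section ImplicitFunction.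
Variable R : realType.
Implicit Types (Q G : {poly {poly R[i]}}) (p u v : {poly R[i]}).

(** A zero of order n at 0 gains t^n when the radius shrinks by t. This makes the coefficients
    [G_0], [G_1] small and the tails of the iterates geometric. *)
Lemma pnorm_scale (t rho : R) n p : 0 <= t <= 1 -> 0 <= rho ->
  (forall i, (i < n)%N -> p`_i = 0) -> pnorm (t * rho) p <= t ^+ n * pnorm rho p.
Proof.
move=> /andP[t0 t1] rho0 low; rewrite /pnorm !horner_poly mulr_sumr ler_sum // => i _.
have [/low->|lei] := ltnP i n; first by rewrite cabs0 !mul0r mulr0.
rewrite exprMn mulrCA ler_wpM2r ?mulr_ge0 ?cabs_ge0 ?exprn_ge0 //.
exact: ler_wiXn2l.
Qed.

Section FixedPoint.
Variable G : {poly {poly R[i]}}.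
Hypotheses (G00 : (G`_0).[0] = 0) (G10 : (G`_1).[0] = 0).

(** First r is chosen so that the terms of degree at least 2 contribute at most 1/4 to the Lipschitz
    constant; then rho, so that the linear term contributes at most 1/4 and the constant term has
    norm at most r / 2. Since H is a polynomial, X-adic estimates are available besides the norm. *)
Lemma contraction : exists rho r : R,
  [/\ 0 < rho <= 1, 0 < r, pnorm rho G.[0] <= r / 2 &
   forall u v, pnorm rho u <= r -> pnorm rho v <= r -> exists H : {poly R[i]},
     [/\ G.[u] - G.[v] = (u - v) * H, pnorm rho H <= 1 / 2 &
         u.[0] = 0 -> v.[0] = 0 -> H.[0] = 0]].
Proof.
pose T : R := \sum_(k < size G) pnorm 1 G`_k *+ k.
have T0 : 0 <= T by apply: sumr_ge0 => k _; rewrite mulrn_wge0 ?pnorm_ge0.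
pose r : R := Num.min 1 (1 / 4 / (T + 1)).
have r0 : 0 < r by rewrite lt_min ltr01 !divr_gt0 ?ltr_wpDl.
have r1 : r <= 1 by rewrite ge_min lexx.
have rT : r * T <= 1 / 4.
  apply: (@le_trans _ _ (r * (T + 1))); first by rewrite ler_wpM2l ?lerDl // ltW.
  by rewrite -ler_pdivlMr ?ltr_wpDl // ge_min lexx orbT.
pose N1 := pnorm 1 G`_1; pose N0 := pnorm 1 G`_0.
have N10 : 0 <= N1 by rewrite pnorm_ge0.
have N00 : 0 <= N0 by rewrite pnorm_ge0.
pose rho : R := Num.min 1 (Num.min (1 / 4 / (N1 + 1)) (r / 2 / (N0 + 1))).
have rho0 : 0 < rho by rewrite !lt_min ltr01 !divr_gt0 ?ltr_wpDl.
have rho1 : rho <= 1 by rewrite ge_min lexx.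
have rho01 : 0 <= rho <= 1 by rewrite ltW.
have small p : p.[0] = 0 -> pnorm rho p <= rho * pnorm 1 p.
  move=> p0; have := @pnorm_scale rho 1 1 p rho01 ler01.
  by rewrite mulr1 expr1; apply; case=> // _; rewrite -horner_coef0.
have rhoN1 : pnorm rho G`_1 <= 1 / 4.
  rewrite (le_trans (small _ G10)) // -/N1.
  apply: (@le_trans _ _ (rho * (N1 + 1))); first by rewrite ler_wpM2l ?lerDl // ltW.
  by rewrite -ler_pdivlMr ?ltr_wpDl // !ge_min lexx orbT.
have rhoN0 : pnorm rho G`_0 <= r / 2.
  rewrite (le_trans (small _ G00)) // -/N0.
  apply: (@le_trans _ _ (rho * (N0 + 1))); first by rewrite ler_wpM2l ?lerDl // ltW.
  by rewrite -ler_pdivlMr ?ltr_wpDl // !ge_min lexx !orbT.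
(* In degree k >= 2 a factor r can be spared; degree 1 is charged to the norm of [G_1] at rho
   instead. *)
have termle (a b c : R) (k : nat) : 0 <= a -> a <= b -> (k = 1%N -> c = a) ->
    a * (r ^+ k.-1 *+ k) <= (k == 1)%:R * c + r * (b *+ k).
  move=> a0 ab; case: k => [|[|k]] ca.
  - by rewrite !mulr0n !mulr0 mul0r addr0.
  - by rewrite ca // eqxx expr0 !mulr1n mul1r mulr1 lerDl mulr_ge0 // ?(le_trans a0 ab) ?ltW.
  - have -> : (k.+2 == 1)%N = false by [].
    rewrite mul0r add0r !mulrnAr ler_wMn2r // mulrC ler_pM ?exprn_ge0 ?(ltW r0) //.
    by rewrite exprS ler_piMr ?(ltW r0) // exprn_ile1 ?(ltW r0).
exists rho, r; split; rewrite ?rho0 ?horner_coef0 // => u v ur vr.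
have rho_ge0 := ltW rho0.
exists (\sum_(k < size G) G`_k * \sum_(i < k) u ^+ (k.-1 - i) * v ^+ i); split.
- rewrite !horner_coef -sumrB mulr_sumr; apply: eq_bigr => k _.
  by rewrite -mulrBr subrXX mulrCA.
- rewrite (le_trans (pnorm_sum _ _ rho_ge0)) //.
  have : \sum_(k < size G) ((k == 1 :> nat)%:R * pnorm rho G`_1 + r * (pnorm 1 G`_k *+ k))
         <= 1 / 2.
    rewrite big_split /= -mulr_suml -mulr_sumr -/T.
    have : \sum_(k < size G) ((k == 1 :> nat)%:R : R) <= 1.
      elim: (size G) => [|n IHn]; first by rewrite big_ord0 ler01.
      rewrite big_ord_recr /=; have [->|n1] := eqVneq n 1%N; last by rewrite addr0.
      by rewrite big_ord_recr big_ord0 /= !add0r.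
    move=> le1; have := ler_wpM2r (pnorm_ge0 G`_1 rho_ge0) le1.
    by rewrite mul1r; move: rT rhoN1; lra.
  apply: le_trans; apply: ler_sum => k _.
  rewrite (le_trans (pnormM _ _ rho_ge0)) //.
  have inner : pnorm rho (\sum_(i < k) u ^+ (k.-1 - i) * v ^+ i) <= r ^+ k.-1 *+ k.
    rewrite (le_trans (pnorm_sum _ _ rho_ge0)) //.
    rewrite -[k in _ *+ k]card_ord -sumr_const ler_sum // => i _.
    rewrite (le_trans (pnormM _ _ rho_ge0)) //.
    have ik : (i <= k.-1)%N by case: (nat_of_ord k) i => [[]|m i] //; rewrite -ltnS.
    rewrite -{2}(subnK ik) exprD ler_pM ?pnorm_ge0 //;
      rewrite (le_trans (pnormX _ _ rho_ge0)) // lerXn2r ?nnegrE ?pnorm_ge0 ?(ltW r0) //.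
  apply: le_trans (ler_wpM2l (pnorm_ge0 _ rho_ge0) inner) _.
  apply: termle; rewrite ?pnorm_ge0 ?pnorm_le //.
  by move=> k1; rewrite k1.
- move=> u0 v0; rewrite horner_sum big1 // => k _; rewrite hornerM horner_sum.
  case: k => -[|[|k]] /= _; rewrite ?big_ord0 ?mulr0 ?G10 ?mul0r //.
  rewrite big1 ?mulr0 // => i _; rewrite hornerM !horner_exp u0 v0 -exprD subnK ?expr0n //.
  by rewrite -ltnS.
Qed.

(* The iterates of [G] from 0 are polynomials that are bounded for the weighted
   l1 norm and stabilise X-adically: their limit is a convergent power series. *)
Lemma analytic_fixed_point : exists (f : R -> R[i]) (e : R),
  [/\ 0 < e, f 0 = 0, analytic_at f 0, forall x, `|x| < e -> ccontinuous_at f x &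
   forall x, `|x| < e -> (G.[(f x)%:P]).[x%:C] = f x /\
     forall w, cabs w < e -> (G.[w%:P]).[x%:C] = w -> w = f x].
Proof.
have [rho [r [/andP[rho0 rho1] r0 leG0 contr]]] := contraction.
have rho_ge0 := ltW rho0; have r_ge0 := ltW r0.
pose phi n : {poly R[i]} := iter n (fun u => G.[u]) 0.
have pnorm0 : pnorm rho 0 = 0 by rewrite -(polyC0 R[i]) pnormC cabs0.
have phiP n : pnorm rho (phi n) <= r /\ (phi n).[0] = 0.
  elim: n => [|n [IHr IH0]]; first by rewrite /phi /= pnorm0 hornerC.
  have [|H [GE Hle _]] := contr (phi n) 0 IHr; first by rewrite pnorm0.
  rewrite /= -/(phi n) -[G.[phi n]](subrK G.[0]) GE subr0; split.
    rewrite (le_trans (pnormD _ _ rho_ge0)) //.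
    have := le_trans (pnormM (phi n) H rho_ge0)
      (ler_pM (pnorm_ge0 _ rho_ge0) (pnorm_ge0 _ rho_ge0) IHr Hle).
    by move: leG0; lra.
  by rewrite hornerD hornerM IH0 mul0r add0r [G.[0]]horner_coef0.
(* The difference of two successive iterates is multiplied by a quotient H with H(0) = 0, so each
   step gains a factor X. *)
have stepP n : 'X^(n.+1) %| phi n.+1 - phi n.
  elim: n => [|n IHn].
    rewrite expr1 -[X in X %| _]subr0 -polyC0 dvdp_XsubCl rootE.
    by rewrite hornerD hornerN (phiP 1%N).2 (phiP 0%N).2 subr0.
  have [H [GE _ H0]] := contr _ _ (phiP n.+1).1 (phiP n).1.
  rewrite [phi n.+2]/= -/(phi n.+1) [in X in _ - X]/phi /= -/(phi n) GE exprSr dvdp_mul //.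
  by rewrite -[X in X %| _]subr0 -polyC0 dvdp_XsubCl rootE H0 ?(phiP _).2.
have stable n j i : (i <= n)%N -> (phi (n + j)%N)`_i = (phi n)`_i.
  move=> lein; elim: j => [|j IHj]; first by rewrite addn0.
  rewrite addnS; apply/eqP; rewrite -IHj -subr_eq0 -coefB.
  have /dvdpP[q ->] := stepP (n + j)%N.
  by rewrite coefMXn ltnS (leq_trans lein) ?leq_addr.
pose a i := (phi i)`_i.
have phia n i : (i < n)%N -> (phi n)`_i = a i.
  by move=> /ltnW lein; rewrite /a -{1}(subnKC lein) stable.
pose S n := \poly_(i < n) a i.
have coefa i : cabs (a i) * rho ^+ i <= r.
  exact: le_trans (pnorm_coef _ i rho_ge0) (phiP i).1.
(* At half the radius, |a_i| rho^i <= r makes the series dominated by a geometric one of ratio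
   1/2. *)
pose h : R := 2^-1.
have h01 : 0 <= h <= 1 by rewrite invr_ge0 ler0n invf_le1 ?ltr0n ?ler1n.
have SP n (z : R[i]) : cabs z <= h * rho -> cabs ((phi n).[z] - (S n).[z]) <= h ^+ n * r.
  move=> lez; rewrite -hornerN -hornerD.
  rewrite (le_trans (pnorm_horner _ lez)) //.
  apply: (le_trans (@pnorm_scale _ _ n _ h01 rho_ge0 _)).
    by move=> i ltin; rewrite coefB coef_poly ltin phia // subrr.
  rewrite ler_wpM2l ?exprn_ge0 ?(andP h01).1 //.
  apply: le_trans (phiP n).1; apply: horner_le_coef => // i.
  rewrite !coef_abs_poly coefB coef_poly; case: ltnP => [ltin|_].
    by rewrite phia // subrr cabs0 cabs_ge0.
  by rewrite subr0.
have SE n (x : R) : (S n).[x%:C] = \sum_(i < n) a i * (x ^+ i)%:C.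
  by rewrite horner_poly; apply: eq_bigr => i _; rewrite rmorphXn.
have cvgS (g : R[i] -> R) (x : R) : (forall z, `|g z| <= cabs z) ->
    `|x| <= h * rho -> cvgn (pseries (g \o a) x).
  move=> gle lex; apply: normed_cvg.
  apply: (@series_le_cvg _ _ (geometric r h)).
  - by move=> n; rewrite /= normr_ge0.
  - by move=> n; rewrite /= mulr_ge0 // exprn_ge0 // (andP h01).1.
  - move=> n; rewrite /= normrM normrX (le_trans (ler_wpM2r _ (gle _))) ?exprn_ge0 //.
    apply: (@le_trans _ _ (cabs (a n) * (h * rho) ^+ n)).
      by rewrite ler_wpM2l ?cabs_ge0 // lerXn2r ?nnegrE // (le_trans _ lex).
    by rewrite exprMn mulrCA mulrC ler_wpM2r ?exprn_ge0 ?(andP h01).1.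
  - apply: is_cvg_geometric_series; rewrite ger0_norm ?(andP h01).1 //.
    by rewrite invf_lt1 ?ltr0n ?ltr1n.
pose re := fun i => complex.Re (a i); pose im := fun i => complex.Im (a i).
pose f (x : R) : R[i] := Complex (limn (pseries re x)) (limn (pseries im x)).
have ReS n (x : R) : complex.Re (S n).[x%:C] = pseries re x n.
  rewrite SE /pseries /series /= big_mkord.
  rewrite (big_morph (@complex.Re R) (id1 := 0) (op1 := +%R)) //; last by case=> ? ? [].
  by apply: eq_bigr => i _; rewrite /re; case: (a i) => u v /=; rewrite mulr0 subr0.
have ImS n (x : R) : complex.Im (S n).[x%:C] = pseries im x n.
  rewrite SE /pseries /series /= big_mkord.
  rewrite (big_morph (@complex.Im R) (id1 := 0) (op1 := +%R)) //; last by case=> ? ? [].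
  by apply: eq_bigr => i _; rewrite /im; case: (a i) => u v /=; rewrite mulr0 add0r.
have cvgf (x : R) : `|x| <= h * rho ->
    pseries re x @ \oo --> complex.Re (f x) /\ pseries im x @ \oo --> complex.Im (f x).
  move=> lex; split.
    exact: (cvgS (@complex.Re R) x (@normr_Re_le R) lex).
  exact: (cvgS (@complex.Im R) x (@normr_Im_le R) lex).
have cvgphi (x : R) : `|x| <= h * rho -> forall e, 0 < e ->
    exists N, forall n, (N <= n)%N -> cabs ((phi n).[x%:C] - f x) < e.
  move=> lex e e0; have e3 : 0 < e / 3 by rewrite divr_gt0.
  have [/cvgrPdist_lt/(_ _ e3)[N1 _ H1] /cvgrPdist_lt/(_ _ e3)[N2 _ H2]] := cvgf x lex.
  have : geometric r h @ \oo --> (0 : R).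
    apply: cvg_geometric; rewrite ger0_norm ?(andP h01).1 //.
    by rewrite invf_lt1 ?ltr0n ?ltr1n.
  move=> /cvgrPdist_lt/(_ _ e3)[N3 _ H3].
  exists (maxn N1 (maxn N2 N3)) => n; rewrite !geq_max => /and3P[n1 n2 n3].
  have := H1 n n1; have := H2 n n2; have := H3 n n3 => /=.
  rewrite sub0r normrN ger0_norm ?mulr_ge0 ?exprn_ge0 ?(andP h01).1 //.
  rewrite mulrC -ReS -ImS => l3 l2 l1.
  have lex' : cabs x%:C <= h * rho by rewrite cabs_real.
  have := SP n _ lex'; have := cabsD ((phi n).[x%:C] - (S n).[x%:C]) ((S n).[x%:C] - f x).
  rewrite addrA subrK; have := cabs_le_ReIm ((S n).[x%:C] - f x).
  rewrite ReB ImB [X in _ <= X + _]distrC [X in _ <= _ + X]distrC.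
  by move: l1 l2 l3; lra.
have xrho (x : R) : `|x| <= h * rho -> cabs x%:C <= rho.
  move=> lex; rewrite cabs_real (le_trans lex) // ler_piMl //; exact: (andP h01).2.
have fr (x : R) : `|x| <= h * rho -> cabs (f x) <= r.
  move=> lex; apply/ler_addgt0Pr => e e0; have [N /(_ N (leqnn _)) lte] := cvgphi x lex e e0.
  have := cabsB (phi N).[x%:C] ((phi N).[x%:C] - f x); rewrite opprB addrC subrK.
  have := le_trans (pnorm_horner (phi N) (xrho x lex)) (phiP N).1.
  by move: lte; lra.
(* A number is a constant polynomial whose norm is its modulus, so [contr] also gives a pointwise
   contraction, from which uniqueness follows. *)
have contrG (x : R) y z : `|x| <= h * rho -> cabs y <= r -> cabs z <= r ->
    cabs ((G.[y%:P]).[x%:C] - (G.[z%:P]).[x%:C]) <= 1 / 2 * cabs (y - z).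
  move=> lex yr zr; have [|//|H [GE Hle _]] := contr y%:P z%:P; rewrite ?pnormC //.
  rewrite -hornerN -hornerD GE hornerM cabsM hornerD hornerN !hornerC mulrC.
  rewrite ler_wpM2r ?cabs_ge0 //.
  exact: le_trans (pnorm_horner _ (xrho x lex)) Hle.
have fixG (x : R) : `|x| <= h * rho -> (G.[(f x)%:P]).[x%:C] = f x.
  move=> lex; apply/eqP; rewrite -subr_eq0 -cabs_eq0 eq_le cabs_ge0 andbT.
  apply/ler_addgt0Pr => e e0; rewrite add0r.
  have [N HN] := cvgphi x lex (e / 2) (divr_gt0 e0 (ltr0Sn _ 1)).
  have := HN N (leqnn _); have := HN N.+1 (leqnSn _).
  have phix : cabs (phi N).[x%:C] <= r.
    exact: le_trans (pnorm_horner (phi N) (xrho x lex)) (phiP N).1.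
  have := contrG x _ _ lex (fr x lex) phix.
  have -> : (G.[(phi N).[x%:C]%:P]).[x%:C] = (phi N.+1).[x%:C].
    by rewrite -horner_spec /= -/(phi N) -[in RHS]horner_evalE -horner_map.
  have := cabsD ((G.[(f x)%:P]).[x%:C] - (phi N.+1).[x%:C]) ((phi N.+1).[x%:C] - f x).
  rewrite addrA subrK [cabs (f x - _)]cabs_distC.
  by move: e0; lra.
pose e := Num.min (h * rho) r.
have h0 : 0 < h by rewrite invr_gt0.
have e0 : 0 < e by rewrite lt_min r0 mulr_gt0.
have lehr (x : R) : `|x| < e -> `|x| <= h * rho.
  by rewrite lt_min => /andP[/ltW].
have uniq (x : R) w : `|x| < e -> cabs w <= r -> (G.[w%:P]).[x%:C] = w -> w = f x.
  move=> /lehr lex wr Gw; apply/eqP; rewrite -subr_eq0 -cabs_eq0 eq_le cabs_ge0 andbT.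
  by have := contrG x _ _ lex wr (fr x lex); rewrite Gw fixG //; lra.
exists f, e; split=> //.
- apply/esym/uniq; rewrite ?normr0 ?cabs0 //.
  by rewrite polyC0 (horner_coef0 G) (_ : 0%:C = 0) ?G00.
- have near0 : \forall x \near (0 : R), `|x| < e.
    by apply/near_normP; exists e => // x; rewrite subr0.
  by split; [exists re | exists im]; apply: filterS near0 => x /lehr lex;
    rewrite subr0; have [] := cvgf x lex.
- move=> x ltx d d0; pose y := f x.
  have [d1 d10 Hd1] := horner_continuous_at G.[y%:P] x%:C (divr_gt0 d0 (ltr0Sn _ 1)).
  exists (Num.min d1 (e - `|x|)) => [|s]; first by rewrite lt_min d10 subr_gt0.
  rewrite lt_min => /andP[lts1 lts2].
  have lts : `|s| < e.
    by have := ler_normD (s - x) x; rewrite subrK; move: lts2; lra.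
  have := Hd1 s%:C; rewrite -rmorphB cabs_real => /(_ lts1).
  rewrite fixG ?lehr // -/y.
  have := contrG s _ _ (lehr s lts) (fr s (lehr s lts)) (fr x (lehr x ltx)).
  rewrite fixG ?lehr // -/y.
  have := cabsD (f s - (G.[y%:P]).[s%:C]) ((G.[y%:P]).[s%:C] - y).
  by rewrite addrA subrK; lra.
- move=> x ltx; split; first by rewrite fixG ?lehr.
  move=> w; rewrite lt_min => /andP[_ /ltW wr]; exact: uniq.
Qed.
End FixedPoint.

(** Newton's map with the derivative b frozen at the origin, G = w - Q / b, has the roots of Q as
    fixed points, and its constant and linear coefficients vanish at x = 0. *)
Lemma implicit_function Q : (spec 0 Q).[0] = 0 -> (spec 0 Q)^`().[0] != 0 ->
  exists (f : R -> R[i]) (e : R),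
  [/\ 0 < e, f 0 = 0, analytic_at f 0, forall x, `|x| < e -> ccontinuous_at f x &
   forall x, `|x| < e -> (spec x%:C Q).[f x] = 0 /\
     forall w, cabs w < e -> (spec x%:C Q).[w] = 0 -> w = f x].
Proof.
rewrite horner_coef0 coef_spec horner_coef0 coef_deriv mulr1n coef_spec.
set b := (Q`_1).[0] => Q00 b0; pose G : {poly {poly R[i]}} := 'X - (b^-1)%:P%:P * Q.
have GE w (x : R[i]) : (G.[w%:P]).[x] = w - b^-1 * (spec x Q).[w].
  by rewrite horner_spec !hornerE.
have [||f [e [e0 f0 an ct fx]]] := @analytic_fixed_point G.
- by rewrite coefB coefX coefCM hornerD hornerN hornerM !hornerC Q00 mulr0 subr0.
- by rewrite coefB coefX coefCM hornerD hornerN hornerM !hornerC -/b mulVf ?subrr.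
exists f, e; split=> // x /fx[].
rewrite GE => /eqP; rewrite -subr_eq0 addrAC subrr add0r oppr_eq0.
rewrite mulf_eq0 invr_eq0 (negPf b0) /= => /eqP Qf uniq; split=> // w we Qw.
by apply: uniq => //; rewrite GE Qw mulr0 subr0.
Qed.

(* Q(t + x, y + w) as a polynomial in (x, w). *)
Definition translate (t y : R[i]) Q : {poly {poly R[i]}} :=
  map_poly (comp_poly ('X + t%:P)) Q \Po ('X + y%:P%:P).

Lemma spec_translate t y Q x :
  spec x (translate t y Q) = spec (t + x) Q \Po ('X + y%:P).
Proof.
rewrite spec_comp rmorphD /= specX specC hornerC; congr (_ \Po _).
rewrite -map_poly_comp; apply: eq_map_poly => p /=.
by rewrite !horner_evalE horner_comp !hornerE addrC.
Qed.

Lemma horner_translate t y Q x w :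
  (spec x (translate t y Q)).[w] = (spec (t + x) Q).[y + w].
Proof. by rewrite spec_translate horner_comp !hornerE [w + y]addrC. Qed.

(** Once (t, f t) is moved to the origin, continuity keeps f(s) - f(t) in the disk where the
    implicit function is the only root, so the two agree. *)
Lemma analytic_simple_root Q (f : R -> R[i]) (t : R) : ccontinuous_at f t ->
  (\forall s \near t, (spec s%:C Q).[f s] = 0) ->
  (spec t%:C Q)^`().[f t] != 0 -> analytic_at f t.
Proof.
move=> ctf rootf simple; have /nbhs_singleton root_t := rootf.
have [||g [e [e0 g0 [[a Ha] [b Hb]] _ gP]]] := @implicit_function (translate t%:C (f t) Q).
- by rewrite horner_translate !addr0.
- rewrite spec_translate addr0 deriv_comp derivD derivX derivC addr0 mulr1.
  by rewrite horner_comp !hornerE.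
have [d d0 Hd] := ctf e e0.
have [d' d'0 Hd'] := (near_normP _ _).1 rootf.
have fE s : `|s - t| < Num.min e (Num.min d d') -> f s = f t + g (s - t).
  rewrite !lt_min => /and3P[lte ltd ltd'].
  have [_ uniq] := gP _ lte; rewrite -(uniq (f s - f t)) ?subrKC ?Hd //.
  by rewrite horner_translate rmorphB /= !subrKC Hd'.
have min0 : 0 < Num.min e (Num.min d d') by rewrite !lt_min e0 d0.
have near_t (P : R -> Prop) : (\forall s \near (0 : R), P s) ->
    \forall s \near t, P (s - t) /\ f s = f t + g (s - t).
  move=> /near_normP[c c0 cP]; apply/near_normP.
  exists (Num.min c (Num.min e (Num.min d d'))) => [|s]; first by rewrite lt_min c0.
  by rewrite lt_min => /andP[ltc /fE ->]; split=> //; apply: cP; rewrite subr0.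
have gt : analytic_at (fun s => f t + g (s - t)) t.
  by split; under eq_fun do rewrite ReImD; apply: real_analytic_at_addl;
    [exists a; apply: filterS (near_t _ Ha) => s []
    |exists b; apply: filterS (near_t _ Hb) => s []]; rewrite subr0.
by split; [apply: real_analytic_at_near gt.1 | apply: real_analytic_at_near gt.2];
  apply: filterS (near_t _ Ha) => s [_ ->].
Qed.
End ImplicitFunction.

(** * Newton polygons and hyperbolic germs *)

Section InitialForms.
Variable R : realType.
Implicit Types (Q : {poly {poly R[i]}}).

(* Q(eps t^b, t^a z) / t^N as a polynomial in (t, z), when N is a lower bound for
   the weights b j + a k of the monomials x^j y^k of Q. *)
Definition weighted_blowup (a b N : nat) (eps : R[i]) Q : {poly {poly R[i]}} :=
  \poly_(k < size Q) \sum_(j < size Q`_k)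
    ((Q`_k)`_j * eps ^+ j) *: 'X^(b * j + a * k - N).

(** The Newton polygon lies on or above the line b j + a k = N, so the subtraction in the exponents
    of [weighted_blowup] never truncates on a monomial of Q. *)
Definition weight_ge (a b N : nat) Q : Prop :=
  forall k j, (Q`_k)`_j != 0 -> (N <= b * j + a * k)%N.

Lemma horner_weighted_blowup a b N eps Q t z : weight_ge a b N Q ->
  t ^+ N * (spec t (weighted_blowup a b N eps Q)).[z] =
  (spec (eps * t ^+ b) Q).[t ^+ a * z].
Proof.
move=> wQ; have szF : (size (spec t (weighted_blowup a b N eps Q)) <= size Q)%N.
  exact: leq_trans (size_spec _ _) (size_poly _ _).
rewrite (horner_coef_wide _ szF) (horner_coef_wide _ (size_spec _ Q)) mulr_sumr.
apply: eq_bigr => k _; rewrite !coef_spec coef_poly ltn_ord mulrA exprMn mulrA.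
congr (_ * _); rewrite horner_sum horner_coef mulr_sumr mulr_suml.
apply: eq_bigr => j _; rewrite hornerZ hornerXn.
have [->|nz] := eqVneq (Q`_k)`_j 0; first by rewrite !mul0r mulr0.
rewrite mulrCA -exprD subnKC ?wQ // exprMn -!mulrA; congr (_ * (_ * _)).
by rewrite -!exprM -exprD.
Qed.

(** At t = 0 only the monomials on the line b j + a k = N survive; since b > 0, each k has at most
    one of them. *)
Lemma coef_weighted_blowup0 a b N eps Q k j : weight_ge a b N Q -> (0 < b)%N ->
  (b * j + a * k = N)%N ->
  (spec 0 (weighted_blowup a b N eps Q))`_k = (Q`_k)`_j * eps ^+ j.
Proof.
move=> wQ b0 jN; rewrite coef_spec coef_poly; case: ltnP => [_|lek]; last first.
  by rewrite [Q`_k]nth_default // coef0 mul0r hornerC.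
have jE i : (Q`_k)`_i != 0 -> (b * i + a * k - N == 0)%N = (i == j).
  move=> /wQ leN; rewrite subn_eq0.
  have -> : (b * i + a * k <= N)%N = (b * i + a * k == N)%N by rewrite eqn_leq leN andbT.
  by rewrite -jN eqn_add2r eqn_mul2l gtn_eqF.
rewrite horner_sum.
have termE (i : 'I_(size Q`_k)) :
    (((Q`_k)`_i * eps ^+ i) *: 'X^(b * i + a * k - N)).[0] =
    (if i == j :> nat then (Q`_k)`_j * eps ^+ j else 0).
  rewrite hornerZ hornerXn expr0n.
  have [z|/jE ->] := eqVneq (Q`_k)`_i 0.
    by rewrite z !mul0r; case: eqP => // ij; rewrite -ij z mul0r.
  by case: eqP => [->|_]; rewrite ?mulr1 ?mulr0.
under eq_bigr do rewrite termE.
rewrite -big_mkcond /=; have [ltj|lej] := ltnP j (size Q`_k).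
  by rewrite (big_pred1 (Ordinal ltj)).
rewrite [(Q`_k)`_j]nth_default // mul0r big_pred0 // => i.
by apply/eqP => ij; move: (ltn_ord i); rewrite ij ltnNge lej.
Qed.

Lemma coef_weighted_blowup0_eq0 a b N eps Q k : weight_ge a b N Q ->
  (forall j, (Q`_k)`_j != 0 -> (b * j + a * k)%N != N) ->
  (spec 0 (weighted_blowup a b N eps Q))`_k = 0.
Proof.
move=> wQ neN; rewrite coef_spec coef_poly; case: ltnP => [_|lek]; last first.
  by rewrite hornerC.
rewrite horner_sum big1 // => i _; rewrite hornerZ hornerXn expr0n.
have [->|nz] := eqVneq (Q`_k)`_i 0; first by rewrite !mul0r.
by rewrite subn_eq0 leqNgt ltn_neqAle eq_sym neN // wQ // mulr0.
Qed.

End InitialForms.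

(** These are Vieta's formula and Newton's identity for the power sum of order 2. Multiplying by X
    or X^2, instead of lowering the index, yields the correct value 0 for lists that are too
    short. *)
Lemma sumsq_prod_XsubC (F : fieldType) (rs : seq F) :
  let P := \prod_(z <- rs) ('X - z%:P) in
  ('X * P)`_(size rs) = - \sum_(z <- rs) z /\
  ('X^2 * P)`_(size rs) *+ 2 = (\sum_(z <- rs) z) ^+ 2 - \sum_(z <- rs) z ^+ 2.
Proof.
elim: rs => [|z rs [IH1 IH2]] /=.
  by rewrite !big_nil !mulr1 coefX coefXn expr0n subr0 oppr0 mul0rn.
have P1 : (\prod_(z <- rs) ('X - z%:P))`_(size rs) = 1.
  by have /monicP := monic_prod_XsubC rs xpredT id; rewrite lead_coefE size_prod_XsubC.
rewrite !big_cons; move: (\prod_(_ <- _) _) P1 IH1 IH2 => P P1 IH1 IH2.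
have XE i : ('X * (('X - z%:P) * P))`_i.+1 = ('X * P)`_i - z * P`_i.
  by rewrite coefXM /= mulrBl coefB coefCM.
split; first by rewrite XE IH1 P1 mulr1 opprD addrC.
have -> : ('X^2 * (('X - z%:P) * P))`_(size rs).+1 =
    ('X^2 * P)`_(size rs) - z * ('X * P)`_(size rs).
  rewrite expr2 -!mulrA coefXM /=; case: (size rs) => [|n]; last by rewrite XE !coefXM.
  by rewrite !coefXM mulr0 subr0.
rewrite mulrnBl IH2 IH1; ring.
Qed.

Section HyperbolicGerms.
Variable R : realType.
Implicit Types (Q : {poly {poly R[i]}}) (C : {poly R[i]}).

(** At the start C = p2 and k = 0; after k blow-ups, C(x) + x^k w is the second coordinate expressed
    in the current w, and C has collected the tangents chosen on the way. *)
Definition roots_on_circle C k Q : Prop :=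
  exists2 e : R, 0 < e & forall (x : R) (w : R[i]), x != 0 -> `|x| < e ->
    cabs w < e -> (spec x%:C Q).[w] = 0 -> cabs (C.[x%:C] + x%:C ^+ k * w) = 1.

Lemma cabs_conjc (z : R[i]) : cabs (conjc z) = cabs z.
Proof. by rewrite /cabs normcJ. Qed.

(** Both squared moduli expand to |c|^2 plus terms in s; subtract and divide by 2 s. As s tends to 0
    with y, y' bounded, the chord becomes orthogonal to c. *)
Lemma circle_chord (c y y' : R[i]) (s : R) : s != 0 ->
  cabs (c + s%:C * y) = 1 -> cabs (c + s%:C * y') = 1 ->
  complex.Re (conjc c * (y - y')) = s / 2 * (cabs y' ^+ 2 - cabs y ^+ 2).
Proof.
move=> s0 /(congr1 (fun t => t ^+ 2)) + /(congr1 (fun t => t ^+ 2)).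
rewrite !sqr_cabs; case: c y y' => [c1 c2] [y1 y2] [z1 z2] /=.
rewrite !mul0r !subr0 !addr0 => <- eqc; apply: (mulfI s0).
by move: eqc; lra.
Qed.

(** By continuity z and z' are limits of roots y and y' at small t > 0, for which C(x) + s y and
    C(x) + s y' lie on the circle, with s = x^k t^a. Since s tends to 0, the chord equation turns
    into that of a line orthogonal to C(0). *)
Lemma limit_roots_on_line C k Q a b N (eps : R) : roots_on_circle C k Q ->
  `|eps| = 1 -> (0 < a)%N -> (0 < b)%N -> weight_ge a b N Q ->
  let E := spec 0 (weighted_blowup a b N eps%:C Q) in E != 0 ->
  forall z z', E.[z] = 0 -> E.[z'] = 0 ->
  complex.Re (conjc C.[0] * (z - z')) = 0.
Proof.
move=> [e e0 circ] eps1 a0 b0 wQ E E0 z z' Ez Ez'.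
apply/eqP; rewrite -normr_eq0; apply: contraT => m_neq0.
set m := `|_| in m_neq0; have mE : m = `|complex.Re (conjc C.[0] * (z - z'))| by [].
have m0 : 0 < m by rewrite lt_def m_neq0 normr_ge0.
pose B := cabs z + cabs z' + 2; pose P := cabs C.[0].
have B0 : 0 < B by rewrite ltr_wpDl ?addr_ge0 ?cabs_ge0.
have P0 : 0 < P + 1 by rewrite ltr_wpDl ?cabs_ge0.
pose eta := Num.min 1 (m / 8 / (P + 1)).
have eta0 : 0 < eta by rewrite lt_min ltr01 !divr_gt0.
have [d1 d10 H1] := root_continuity E0 Ez eta0.
have [d2 d20 H2] := root_continuity E0 Ez' eta0.
have mB0 : 0 < m / 8 / B by rewrite !divr_gt0.
have [d3 d30 H3] := horner_continuous_at C 0 mB0.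
pose M := Num.min (Num.min (Num.min d1 d2) (Num.min d3 1))
                  (Num.min (Num.min e (e / B)) (m / 4 / B ^+ 2)).
have M0 : 0 < M by rewrite !lt_min d10 d20 d30 ltr01 e0 !divr_gt0 ?exprn_gt0.
pose t := M / 2; have t0 : 0 < t by rewrite divr_gt0.
have : t < M by rewrite /t; move: M0; lra.
rewrite !lt_min => /andP[/andP[/andP[t1 t2] /andP[t3 tl1]] /andP[/andP[te teB] tm]].
have tn n : (0 < n)%N -> t ^+ n <= t.
  by case: n => // n _; rewrite exprS ler_piMr ?(ltW t0) // exprn_ile1 ?(ltW t0) ?(ltW tl1).
pose x : R := eps * t ^+ b.
have xn : `|x| = t ^+ b by rewrite normrM eps1 mul1r ger0_norm // exprn_ge0 ?ltW.
have x0 : x != 0 by rewrite -normr_eq0 xn expf_neq0 ?gt_eqF.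
have xt : `|x| <= t by rewrite xn tn.
pose s : R := x ^+ k * t ^+ a.
have tn0 : t != 0 by rewrite gt_eqF.
have s0 : s != 0 by apply: mulf_neq0; apply: expf_neq0.
have st : `|s| <= t.
  rewrite normrM !normrX (ger0_norm (ltW t0)) (le_trans _ (tn a a0)) //.
  by rewrite ler_piMl ?exprn_ge0 ?(ltW t0) // exprn_ile1 // (le_trans xt) // ltW.
have onc y : cabs y <= B -> (spec t%:C (weighted_blowup a b N eps%:C Q)).[y] = 0 ->
    cabs (C.[x%:C] + s%:C * y) = 1.
  move=> yB rooty.
  have -> : s%:C * y = x%:C ^+ k * (t%:C ^+ a * y) by rewrite /s rmorphM !rmorphXn mulrA.
  apply: circ => //; first exact: le_lt_trans xt te.
    rewrite cabsM cabsX cabs_real (ger0_norm (ltW t0)).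
    have tBe : t * B < e by rewrite -ltr_pdivlMr.
    by apply: le_lt_trans tBe; rewrite ler_pM ?exprn_ge0 ?cabs_ge0 ?(ltW t0) ?tn.
  have -> : x%:C = eps%:C * t%:C ^+ b by rewrite /x rmorphM rmorphXn.
  by rewrite -(horner_weighted_blowup _ _ _ wQ) rooty mulr0.
have tC : cabs (t%:C - 0) = t by rewrite subr0 cabs_real ger0_norm // ltW.
have [|y yz rooty] := H1 t%:C; first by rewrite tC.
have [|y' yz' rooty'] := H2 t%:C; first by rewrite tC.
have eta1 : eta <= 1 by rewrite ge_min lexx.
have etaP : eta * (P + 1) <= m / 8 by rewrite -ler_pdivlMr // ge_min lexx orbT.
have yB : cabs y + cabs y' <= B.
  have := cabsD (y - z) z; have := cabsD (y' - z') z'; rewrite !subrK /B.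
  by clear - yz yz' eta1; lra.
have := circle_chord s0 (onc y _ rooty) (onc y' _ rooty').
have y0 := cabs_ge0 y; have y'0 := cabs_ge0 y'.
move=> /(_ (le_trans _ yB) (le_trans _ yB)); rewrite lerDl lerDr => /(_ y'0 y0) chord.
have chord_le : `|complex.Re (conjc C.[x%:C] * (y - y'))| <= m / 4.
  rewrite chord normrM (normrM s) [`|2^-1|]ger0_norm ?invr_ge0 //.
  have sq : `|cabs y' ^+ 2 - cabs y ^+ 2| <= B ^+ 2.
    rewrite ler_norml; have : cabs y ^+ 2 <= B ^+ 2.
      by rewrite lerXn2r ?nnegrE ?(ltW B0) // (le_trans _ yB) ?lerDl.
    have : cabs y' ^+ 2 <= B ^+ 2.
      by rewrite lerXn2r ?nnegrE ?(ltW B0) // (le_trans _ yB) ?lerDr.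
    have := sqr_ge0 (cabs y); have := sqr_ge0 (cabs y').
    by clear; lra.
  have B20 : 0 < B ^+ 2 by rewrite exprn_gt0.
  have tB : t * B ^+ 2 <= m / 4 by rewrite -ler_pdivlMr // ltW.
  have s20 : 0 <= `|s| / 2 by rewrite divr_ge0.
  rewrite (le_trans (ler_wpM2l s20 sq)) //.
  have := ler_wpM2r (ltW B20) st; have := mulr_ge0 (normr_ge0 s) (ltW B20).
  by clear - tB; lra.
(* The error splits into the displacement of the roots (at most m/4), that of C (at most m/8) and
   the chord (at most m/4); the total is below m. *)
have E1 : conjc C.[0] * (z - z') = conjc C.[0] * ((z - y) - (z' - y')) +
    (conjc (C.[0] - C.[x%:C]) * (y - y') + conjc C.[x%:C] * (y - y')).
  by rewrite rmorphB /=; ring.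
have := le_trans (normr_Re_le _) (cabsD (conjc C.[0] * ((z - y) - (z' - y')))
  (conjc (C.[0] - C.[x%:C]) * (y - y'))).
rewrite !cabsM !cabs_conjc -/P => le1.
have le_m : m <= P * cabs (z - y - (z' - y')) + cabs (C.[0] - C.[x%:C]) * cabs (y - y') + m / 4.
  rewrite {1}mE E1 addrA ReD (le_trans (ler_normD _ _)) // lerD //.
have lezy : cabs (z - y - (z' - y')) <= 2 * eta.
  have := cabsB (z - y) (z' - y'); rewrite [cabs (z - y)]cabs_distC.
  by rewrite [cabs (z' - y')]cabs_distC; clear - yz yz'; lra.
have leC : cabs (C.[0] - C.[x%:C]) <= m / 8 / B.
  rewrite cabs_distC ltW // H3 // subr0 cabs_real.
  exact: le_lt_trans xt t3.
have leyy := cabsB y y'.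
have P00 : 0 <= P := cabs_ge0 _.
have := ler_pM (cabs_ge0 _) (cabs_ge0 _) leC (le_trans leyy yB).
rewrite divfK ?gt_eqF // => le2.
have le3 := ler_wpM2l P00 lezy.
suff : m < m by rewrite ltxx.
by move: (ltW eta0); clear - le_m le3 le2 etaP m0; lra.
Qed.

End HyperbolicGerms.

Section NewtonPolygon.
Variable R : realType.
Implicit Types (Q : {poly {poly R[i]}}) (C : {poly R[i]}).

(** Minimising j / (n - k) over the monomials with k < n selects the Newton edge that ends at w^n.
    The monomial (k0, j0) forces the minimum below 1, and the vanishing at x = 0 makes it
    positive. *)
Lemma steepest_slope Q n k0 j0 : (forall k, (k < n)%N -> (Q`_k).[0] = 0) ->
  (Q`_k0)`_j0 != 0 -> (j0 + k0 < n)%N -> exists a k1,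
  [/\ (0 < a)%N, (k1 < n)%N, (a < n - k1)%N, (Q`_k1)`_a != 0 &
      weight_ge a (n - k1) (a * n) Q].
Proof.
move=> low nz0 lt0.
have k0n : (k0 < n)%N by rewrite (leq_ltn_trans _ lt0) ?leq_addl.
have szj k j : (Q`_k)`_j != 0 -> (j < sizeY Q)%N.
  move=> nz; apply: leq_trans (max_size_coefXY Q k).
  by rewrite ltnNge; apply: contra nz => le; rewrite nth_default.
pose I := ('I_n * 'I_(sizeY Q))%type.
pose P (p : I) := (Q`_p.1)`_p.2 != 0.
(* The common denominator n! makes the quotients j / (n - k) comparable as natural numbers. *)
pose W (p : I) := (p.2 * (n`! %/ (n - p.1)))%N.
pose p0 : I := (Ordinal k0n, Ordinal (szj _ _ nz0)).
have P0 : P p0 by [].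
case: (arg_minnP W P0) => -[k1 a] /=; rewrite /P /= => nz1 minW.
have factK (k : nat) : (k < n)%N -> (n`! %/ (n - k) * (n - k) = n`!)%N.
  by move=> kn; rewrite divnK // dvdn_fact // subn_gt0 kn leq_subr.
have slope k j : (k < n)%N -> (Q`_k)`_j != 0 -> (a * (n - k) <= j * (n - k1))%N.
  move=> kn nz; have := minW (Ordinal kn, Ordinal (szj _ _ nz)) nz; rewrite /W /=.
  rewrite -(leq_pmul2r (_ : 0 < (n - k1) * (n - k)))%N; last first.
    by rewrite muln_gt0 !subn_gt0 ltn_ord kn.
  have -> : (a * (n`! %/ (n - k1)) * ((n - k1) * (n - k)) =
             (n`! %/ (n - k1) * (n - k1)) * (a * (n - k)))%N by ring.
  have -> : (j * (n`! %/ (n - k)) * ((n - k1) * (n - k)) =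
             (n`! %/ (n - k) * (n - k)) * (j * (n - k1)))%N by ring.
  by rewrite !factK ?ltn_ord // leq_pmul2l ?fact_gt0.
exists a, k1; split=> //.
- rewrite lt0n; apply: contraNneq nz1 => ->.
  by rewrite -horner_coef0 low ?ltn_ord.
- have := slope _ _ k0n nz0 => le0.
  have lt1 : (j0 < n - k0)%N by rewrite ltn_subRL addnC.
  rewrite -(ltn_pmul2r (_ : 0 < n - k0)%N) ?subn_gt0 //.
  by rewrite (leq_ltn_trans le0) // [ltnRHS]mulnC ltn_pmul2r // subn_gt0 ltn_ord.
- move=> k j nz; have [kn|nk] := ltnP k n; last first.
    by rewrite (leq_trans _ (leq_addl _ _)) // leq_mul2l nk orbT.
  rewrite [X in (_ <= X + _)%N]mulnC -{1}(subnK (ltnW kn)) mulnDr leq_add2r.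
  exact: slope.
Qed.

Lemma Re_realM (c : R) (z : R[i]) : complex.Re (c%:C * z) = c * complex.Re z.
Proof. by case: z => u v /=; rewrite mul0r subr0. Qed.

Lemma Im_realM (c : R) (z : R[i]) : complex.Im (c%:C * z) = c * complex.Im z.
Proof. by case: z => u v /=; rewrite mul0r addr0. Qed.

(* Along the steepest edge of the Newton polygon the limit roots sum to 0 and
   lie on a line, hence on a line through 0, so the sum of their squares is a
   nonpositive multiple of C(0)^2; this sum changes sign with x when the slope
   is smaller than 1. *)
Lemma hyperbolic_order C k Q n : roots_on_circle C k Q -> C.[0] != 0 ->
  (forall j, (j < n)%N -> (Q`_j).[0] = 0) -> (Q`_n).[0] != 0 ->
  weight_ge 1 1 n Q.
Proof.
move=> circ C0 low An k0 j0 nz0; rewrite !mul1n leqNgt; apply/negP => lt0.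
have [a [k1 [a0 k1n ab nz1 wQ]]] := steepest_slope low nz0 lt0.
set b := (n - k1)%N in ab wQ.
have b0 : (0 < b)%N := ltn_trans a0 ab.
have n2 : (1 < n)%N.
  by apply: leq_trans (leq_subr k1 n); apply: leq_ltn_trans ab.
pose E (eps : R) := spec 0 (weighted_blowup a b (a * n) eps%:C Q).
have En eps : (E eps)`_n = (Q`_n).[0].
  by rewrite (@coef_weighted_blowup0 _ _ _ _ _ _ _ 0%N) ?muln0 // expr0 mulr1 -horner_coef0.
have Egt eps i : (n < i)%N -> (E eps)`_i = 0.
  move=> ni; apply: coef_weighted_blowup0_eq0 => // j _.
  by rewrite gtn_eqF // (@leq_trans (a * i)) ?leq_addl // ltn_pmul2l.
have szE eps : size (E eps) = n.+1.
  apply/eqP; rewrite eqn_leq; apply/andP; split.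
    by apply/leq_sizeP => i; apply: Egt.
  by rewrite ltnNge; apply: contra An => /leq_sizeP/(_ n (leqnn _)); rewrite En => ->.
have nk_low i j : (i < n)%N -> (Q`_i)`_j != 0 -> (0 < j)%N.
  move=> lein; rewrite lt0n; apply: contraNneq => ->.
  by rewrite -horner_coef0 low.
(* A monomial with w^(n-1) on the edge would need b j = a with j >= 1, which a < b excludes. Hence
   the limit roots sum to 0. *)
have En1 eps : (E eps)`_n.-1 = 0.
  apply: coef_weighted_blowup0_eq0 => // j /nk_low j0'.
  have {}j0' : (0 < j)%N by apply: j0'; rewrite prednK // ltnW.
  have -> : (a * n = a + a * n.-1)%N by rewrite -mulnS prednK // ltnW.
  by rewrite eqn_add2r gtn_eqF // (leq_trans ab) // leq_pmulr.
(* A monomial with w^(n-2) on the edge needs b j = 2 a with j >= 1; as a < b, only j = 1 is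
   possible, and the coefficient is linear in eps. This is the source of the sign change. *)
have [q Eq] : exists q, forall eps, (E eps)`_n.-2 = eps%:C * q.
  have aE : (a * n = a * 2 + a * n.-2)%N by rewrite -mulnDr add2n -[in LHS](subnKC n2) subn2.
  have [b2|b2] := eqVneq b (a * 2)%N.
    exists (Q`_n.-2)`_1 => eps.
    have := @coef_weighted_blowup0 _ a b (a * n) eps%:C Q n.-2 1%N wQ b0.
    by rewrite muln1 expr1 mulrC; apply; rewrite aE b2.
  exists 0 => eps; rewrite mulr0; apply: coef_weighted_blowup0_eq0 => // j /nk_low j0'.
  have {}j0' : (0 < j)%N by apply: j0'; case: (n) n2 => [|[]].
  rewrite aE eqn_add2r; case: j j0' => [//|[_|j _]]; first by rewrite muln1.
  by rewrite gtn_eqF // (@leq_trans (b * 2)) ?ltn_pmul2r // leq_pmul2l.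
pose alpha := (Q`_n).[0].
have lead eps : lead_coef (E eps) = alpha by rewrite lead_coefE szE En.
have E_neq0 eps : E eps != 0 by rewrite -size_poly_gt0 szE.
pose p := conjc C.[0].
have p0 : p != 0 by rewrite -cabs_eq0 cabs_conjc cabs_eq0.
(* By Newton's identity, eps * kappa is the real part of the sum of (p z)^2 over the limit roots z.
   As each p z turns out to be purely imaginary, this sum is nonpositive. *)
pose kappa := complex.Re (p ^+ 2 * (- (q / alpha) *+ 2)).
have key eps : `|eps| = 1 ->
    eps * kappa <= 0 /\ (eps * kappa = 0 -> E eps = alpha *: 'X^n).
  move=> eps1; have [rs] := closed_field_poly_normal (E eps); rewrite lead => Ers.
  have szrs : size rs = n.
    by have := szE eps; rewrite Ers size_scale // size_prod_XsubC => -[].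
  have [S1 S2] := sumsq_prod_XsubC rs; rewrite szrs in S1 S2.
  have rootrs z : z \in rs -> (E eps).[z] = 0.
    by move=> zrs; rewrite Ers hornerZ (rootP _) ?mulr0 // root_prod_XsubC.
  have coefP i : (E eps)`_i = alpha * (\prod_(z <- rs) ('X - z%:P))`_i.
    by rewrite Ers coefZ.
  have sum0 : \sum_(z <- rs) z = 0.
    apply/eqP; rewrite -oppr_eq0 -S1 coefXM gtn_eqF ?(ltnW n2) //.
    by rewrite -(mulrI_eq0 _ (mulfI An)) -coefP En1.
  have line z z' : z \in rs -> z' \in rs -> complex.Re (p * z) = complex.Re (p * z').
    move=> /rootrs zrs /rootrs zrs'; apply/eqP; rewrite -subr_eq0 -ReB -mulrBr; apply/eqP.
    exact: (limit_roots_on_line circ eps1 a0 b0 wQ (E_neq0 eps) zrs zrs').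
  have Re_sum (I : seq R[i]) (F : R[i] -> R[i]) :
      complex.Re (\sum_(z <- I) F z) = \sum_(z <- I) complex.Re (F z).
    by rewrite (big_morph (@complex.Re R) (id1 := 0) (op1 := +%R)) // => ? ?; rewrite ReD.
  have Re0 z : z \in rs -> complex.Re (p * z) = 0.
    move=> zrs; have : \sum_(y <- rs) complex.Re (p * y) = 0.
      by rewrite -Re_sum -mulr_sumr sum0 mulr0.
    rewrite (eq_big_seq (fun=> complex.Re (p * z))); last by move=> y yrs; apply: line.
    rewrite big_const_seq count_predT szrs iter_addr_0 => /eqP.
    by rewrite mulrn_eq0 gtn_eqF 1?ltnW //= => /eqP.
  have sqE : eps * kappa = \sum_(z <- rs) - complex.Im (p * z) ^+ 2.
    have -> : eps * kappa = complex.Re (\sum_(z <- rs) (p * z) ^+ 2).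
      under eq_bigr do rewrite exprMn.
      have P2 : (\prod_(z <- rs) ('X - z%:P))`_n.-2 = eps%:C * q / alpha.
        by rewrite -Eq coefP mulrAC divff ?mul1r.
      move: S2; rewrite sum0 expr0n sub0r coefXnM ltnNge n2 /= subn2 P2 => /(congr1 -%R).
      rewrite opprK -mulr_sumr => <-; rewrite -Re_realM; congr complex.Re.
      by ring.
    rewrite Re_sum; apply: eq_big_seq => z /Re0.
    by case: (p * z) => u v /= ->; rewrite !expr2 /= mul0r sub0r.
  split; first by rewrite sqE sumr_le0 // => z _; rewrite oppr_le0 sqr_ge0.
  rewrite sqE sumrN => /eqP; rewrite oppr_eq0 psumr_eq0; last by move=> z _; exact: sqr_ge0.
  move=> /allP Im0; rewrite Ers; congr (_ *: _).
  rewrite (eq_big_seq (fun=> 'X)) => [|z zrs].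
    by rewrite big_const_seq count_predT szrs iter_mulr_1.
  have : p * z = 0.
    apply/eqP; rewrite eq_complex Re0 // eqxx /=.
    by have := Im0 z zrs; rewrite expf_eq0.
  by move/eqP; rewrite mulf_eq0 (negPf p0) /= => /eqP ->; rewrite subr0.
(* The two signs of eps force kappa = 0, so E is a multiple of X^n, against the nonzero coefficient
   of the edge at k1 < n. *)
have [le1 eq1] := key 1 (normr1 _).
have [] := key (-1) _; first by rewrite normrN1.
move: le1 eq1; rewrite mul1r mulN1r oppr_le0 => le1 eq1 ge1 _.
have /eq1 E1 : kappa = 0 by apply/eqP; rewrite eq_le le1.
move/eqP: nz1; apply.
have := @coef_weighted_blowup0 _ a b (a * n) 1%:C Q k1 a wQ b0.
have -> : (b * a + a * k1 = a * n)%N.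
  by rewrite mulnC -mulnDr subnK // ltnW.
move=> /(_ erefl); rewrite -/(E 1) E1 coefZ coefXn ltn_eqF // mulr0.
by rewrite expr1n mulr1.
Qed.
End NewtonPolygon.

(** * Branches through the origin *)

Section Branches.
Variable R : realType.
Implicit Types (Q : {poly {poly R[i]}}) (C D : {poly R[i]}).

Lemma horner_inj (p q : {poly R[i]}) : (forall z, p.[z] = q.[z]) -> p = q.
Proof.
move=> eq_pq; apply/eqP; rewrite -subr_eq0; apply: contraT => d0.
pose rs : seq R[i] := [seq i%:R | i <- iota 0 (size (p - q))].
have := @max_poly_roots _ _ rs d0; rewrite size_map size_iota ltnn => -> //.
  by apply/allP => z _; rewrite rootE !hornerE eq_pq subrr.
rewrite map_inj_in_uniq ?iota_uniq // => i j _ _ /eqP.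
by rewrite eqr_nat => /eqP.
Qed.

Lemma spec_inj (P Q : {poly {poly R[i]}}) :
  (forall x z, (spec x P).[z] = (spec x Q).[z]) -> P = Q.
Proof.
move=> eqPQ; apply/polyP => k; apply: horner_inj => x.
rewrite -!coef_spec (_ : spec x P = spec x Q) //.
exact/horner_inj/eqPQ.
Qed.

Lemma size_initial_form n Q : weight_ge 1 1 n Q -> (Q`_n).[0] != 0 ->
  size (spec 0 (weighted_blowup 1 1 n 1 Q)) = n.+1 /\
  lead_coef (spec 0 (weighted_blowup 1 1 n 1 Q)) = (Q`_n).[0].
Proof.
move=> wQ An; set E := spec 0 _.
have En : E`_n = (Q`_n).[0].
  by rewrite (@coef_weighted_blowup0 _ _ _ _ _ _ _ 0%N) ?mul1n ?muln0 // expr0 mulr1 -horner_coef0.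
have szE : size E = n.+1.
  apply/eqP; rewrite eqn_leq; apply/andP; split; last first.
    by rewrite ltnNge; apply: contra An => /leq_sizeP/(_ n (leqnn _)); rewrite En => ->.
  apply/leq_sizeP => i ni; apply: coef_weighted_blowup0_eq0 => // j _.
  by rewrite !mul1n gtn_eqF // (leq_trans ni) ?leq_addl.
by rewrite lead_coefE szE En.
Qed.

Lemma horner_blowup n Q x z :
  (spec x (weighted_blowup 1 1 n 1 Q)).[z] =
  \sum_(k < size Q) \sum_(j < size Q`_k) (Q`_k)`_j * (x ^+ (j + k - n) * z ^+ k).
Proof.
rewrite (horner_coef_wide _ (leq_trans (size_spec _ _) (size_poly _ _))).
apply: eq_bigr => k _; rewrite coef_spec coef_poly ltn_ord horner_sum mulr_suml.
by apply: eq_bigr => j _; rewrite hornerZ hornerXn expr1n mulr1 !mul1n mulrA.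
Qed.

(* The initial form dominates the remaining terms of Q near the origin. *)
Lemma roots_near_tangents n Q (eta : R) : weight_ge 1 1 n Q -> (Q`_n).[0] != 0 ->
  0 < eta -> exists2 d : R, 0 < d & forall x w : R[i], x != 0 -> cabs x < d ->
    cabs (x * w) < d -> (spec x (weighted_blowup 1 1 n 1 Q)).[w] = 0 ->
    exists2 c, (spec 0 (weighted_blowup 1 1 n 1 Q)).[c] = 0 & cabs (w - c) < eta.
Proof.
move=> wQ An eta0; have [szE leadE] := size_initial_form wQ An.
set E := spec 0 _ in szE leadE *.
have [rs Ers] := closed_field_poly_normal E; rewrite leadE in Ers.
have szrs : size rs = n.
  by have := szE; rewrite Ers size_scale // size_prod_XsubC => -[].
pose S : R := \sum_(k < size Q) \sum_(j < size Q`_k) cabs (Q`_k)`_j.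
have S0 : 0 <= S by apply: sumr_ge0 => k _; apply: sumr_ge0 => j _; exact: cabs_ge0.
pose K : R := 1 + \sum_(c <- rs) cabs c.
have K1 : 1 <= K by rewrite lerDl sumr_ge0 // => c _; exact: cabs_ge0.
(* Distances to the roots of E are measured relative to m = max(1, |w|). If |w - c| < th m, the
   bound th <= 1/2 gives m <= 2 K, and then th m <= eta. *)
pose th := Num.min (1 / 2) (eta / 2 / K).
have th0 : 0 < th by rewrite lt_min !divr_gt0 // (lt_le_trans _ K1).
have thK : th * (2 * K) <= eta.
  rewrite mulrA -ler_pdivlMr ?(lt_le_trans _ K1) // -ler_pdivlMr //.
  by rewrite [eta / K / 2]mulrAC ge_min lexx orbT.
have th2 : th <= 1 / 2 by rewrite ge_min lexx.
pose al := cabs (Q`_n).[0]; have al0 : 0 < al by rewrite cabs_gt0.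
have S1 : 0 < S + 1 by rewrite ltr_wpDl.
pose d := Num.min 1 (al * th ^+ n / (S + 1)).
have d0 : 0 < d by rewrite lt_min ltr01 divr_gt0 ?mulr_gt0 ?exprn_gt0.
exists d => // x w x0 xd xwd rootw; pose m := Num.max 1 (cabs w).
have d1 : d <= 1 by rewrite ge_min lexx.
have dS : d * S < al * th ^+ n.
  apply: (@lt_le_trans _ _ (d * (S + 1))); first by rewrite ltr_pM2l // ltrDl.
  by rewrite -ler_pdivlMr // ge_min lexx orbT.
have m1 : 1 <= m by rewrite le_max lexx.
have m0 : 0 < m := lt_le_trans ltr01 m1.
have wm : cabs w <= m by rewrite le_max lexx orbT.
have term (k j : nat) : (Q`_k)`_j != 0 ->
    cabs (x ^+ (j + k - n) * w ^+ k - 0 ^+ (j + k - n) * w ^+ k) <= d * m ^+ n.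
  move=> /wQ; rewrite !mul1n leq_eqVlt => /orP[/eqP <-|lt_n].
    by rewrite subnn !expr0 subrr cabs0 mulr_ge0 ?exprn_ge0 ?ltW.
  have pos : (0 < j + k - n)%N by rewrite subn_gt0.
  rewrite [0 ^+ _]expr0n gtn_eqF // mul0r subr0.
  have [kn|nk] := leqP k n.
    rewrite cabsM !cabsX ler_pM ?exprn_ge0 ?cabs_ge0 //.
      rewrite -(prednK pos) exprS (le_trans (ler_piMr _ _)) ?cabs_ge0 ?(ltW xd) //.
      by rewrite exprn_ile1 ?cabs_ge0 // (le_trans (ltW xd)).
    rewrite (@le_trans _ _ (m ^+ k)) ?lerXn2r ?nnegrE ?cabs_ge0 ?(ltW m0) //.
    exact: ler_weXn2l.
  (* For k > n the power w^k may exceed m^n; its surplus is paired with factors x into powers of the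
     small product x w. *)
  have -> : x ^+ (j + k - n) * w ^+ k = x ^+ j * (x * w) ^+ (k - n) * w ^+ n.
    by rewrite -addnBA ?(ltnW nk) // exprD exprMn -!mulrA -exprD subnK // ltnW.
  rewrite cabsM cabsM !cabsX ler_pM ?mulr_ge0 ?exprn_ge0 ?cabs_ge0 //; last first.
    by rewrite lerXn2r ?nnegrE ?cabs_ge0 ?(ltW m0).
  have pos' : (0 < k - n)%N by rewrite subn_gt0.
  have xj : cabs x ^+ j <= 1 by rewrite exprn_ile1 ?cabs_ge0 // (le_trans (ltW xd)).
  rewrite (le_trans (ler_piMl _ xj)) ?exprn_ge0 ?cabs_ge0 //.
  rewrite -(prednK pos') exprS (le_trans (ler_piMr _ _)) ?cabs_ge0 ?(ltW xwd) //.
  by rewrite exprn_ile1 ?cabs_ge0 // (le_trans (ltW xwd)).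
have Ew : cabs E.[w] <= S * (d * m ^+ n).
  rewrite -cabsN -[- _]add0r -rootw !horner_blowup -sumrB.
  rewrite (le_trans (cabs_sum _ _ _)) // mulr_suml ler_sum // => k _.
  rewrite -sumrB (le_trans (cabs_sum _ _ _)) // mulr_suml ler_sum // => j _.
  rewrite -mulrBr cabsM; have [->|nz] := eqVneq (Q`_k)`_j 0.
    by rewrite cabs0 !mul0r.
  by rewrite ler_wpM2l ?cabs_ge0 ?term.
have [c crs lt_c] : exists2 c, c \in rs & cabs (w - c) < th * m.
  have [/hasP[c crs lt_c]|/hasPn far] := boolP (has (fun c => cabs (w - c) < th * m) rs).
    by exists c.
  exfalso; have : al * (th * m) ^+ n <= cabs E.[w].
    rewrite Ers hornerZ cabsM ler_wpM2l ?(ltW al0) // -szrs.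
    have thm0 : 0 <= th * m by rewrite mulr_ge0 // ltW.
    elim: (rs) far => [|c s IH] far; first by rewrite big_nil hornerC cabs1.
    rewrite big_cons exprS hornerM cabsM ler_pM ?exprn_ge0 //.
      by rewrite !hornerE leNgt far // mem_head.
    by apply: IH => y ys; apply: far; rewrite inE ys orbT.
  apply/negP; rewrite -ltNge (le_lt_trans Ew) // mulrA [S * d]mulrC exprMn mulrA.
  by rewrite ltr_pM2r ?exprn_gt0.
have cK : 1 + cabs c <= K.
  rewrite lerD2l (big_rem c crs) /= lerDl sumr_ge0 // => y _; exact: cabs_ge0.
have /rootP rootc : root (\prod_(z <- rs) ('X - z%:P)) c by rewrite root_prod_XsubC.
exists c; first by rewrite Ers hornerZ rootc mulr0.
apply: (lt_le_trans lt_c); apply: le_trans thK; rewrite ler_wpM2l ?(ltW th0) //.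
have := ler_wpM2r (ltW m0) th2; have := cabsD (w - c) c; rewrite subrK.
have := cabs_ge0 c; move: lt_c; rewrite /m maxEle; case: ifP => _ lt_c c0 lew lem.
  by clear - lt_c c0 lew lem cK; lra.
by clear - cK c0; lra.
Qed.

(** Roots are controlled for x <> 0 only, which is all that a blow-up transports. Analyticity is
    recorded at 0 alone: elsewhere it will follow from continuity and the simplicity of the
    roots. *)
Definition has_branches Q : Prop :=
  exists (fs : seq (R -> R[i])) (e : R),
  [/\ 0 < e,
      forall f, f \in fs -> [/\ f 0 = 0, analytic_at f 0,
        forall x, `|x| < e -> ccontinuous_at f x &
        forall x, x != 0 -> `|x| < e -> (spec x%:C Q).[f x] = 0] &
      forall (x : R) w, x != 0 -> `|x| < e -> cabs w < e -> (spec x%:C Q).[w] = 0 ->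
        exists2 f, f \in fs & w = f x].

(** By the chain rule, Q_w(x, x w) = x^(n-1) Q1_w(x, w), so the substitution makes x^(n-1) a factor
    of the whole identity. The remaining combination W is constant in w because x^(n-1) W = D is. *)
Lemma bezout_blowup n Q (Q1 A B : {poly {poly R[i]}}) D : (0 < n)%N -> D != 0 ->
  A * Q + B * Q^`() = D%:P -> Q \Po ('X%:P * 'X) = 'X^n *: Q1 ->
  exists A1 B1 D1, [/\ A1 * Q1 + B1 * Q1^`() = D1%:P, D1 != 0 & D = 'X^(n.-1) * D1].
Proof.
move=> n0 D0 bez QE; pose X1 : {poly {poly R[i]}} := 'X%:P * 'X.
have XC0 : 'X%:P != 0 :> {poly {poly R[i]}} by rewrite polyC_eq0 polyX_eq0.
have dQE : Q^`() \Po X1 = 'X^(n.-1) *: Q1^`().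
  apply: (mulIf XC0); have := congr1 (fun p => p^`()) QE.
  rewrite deriv_comp derivZ derivM derivC derivX mul0r add0r mulr1 => ->.
  by rewrite [RHS]mulrC mul_polyC scalerA -exprS prednK.
pose W := (A \Po X1) * 'X%:P * Q1 + (B \Po X1) * Q1^`().
have WE : 'X^(n.-1) *: W = D%:P.
  have <- : (A * Q + B * Q^`()) \Po X1 = D%:P by rewrite bez comp_polyC.
  rewrite comp_polyD !comp_polyM QE dQE -!mul_polyC /W.
  have -> : ('X^n)%:P = ('X^(n.-1))%:P * 'X%:P :> {poly {poly R[i]}}.
    by rewrite -polyCM -exprSr prednK.
  by ring.
have WC : W = (W`_0)%:P.
  apply/polyP => -[|i]; rewrite coefC //=.
  have /eqP := congr1 (fun p : {poly {poly R[i]}} => p`_i.+1) WE.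
  by rewrite coefC coefZ mulf_eq0 expf_eq0 polyX_eq0 andbF /= => /eqP.
exists ((A \Po X1) * 'X%:P), (B \Po X1), W`_0.
have DE : D = 'X^(n.-1) * W`_0.
  by have := congr1 (fun p : {poly {poly R[i]}} => p`_0) WE; rewrite coefC coefZ.
by split=> //; apply: contraNneq D0 => W0; rewrite DE W0 mulr0.
Qed.

Lemma bezout_shift (c : R[i]) Q (A B : {poly {poly R[i]}}) D :
  A * Q + B * Q^`() = D%:P -> let s := 'X + c%:P%:P in
  (A \Po s) * (Q \Po s) + (B \Po s) * (Q \Po s)^`() = D%:P.
Proof.
move=> bez s; rewrite deriv_comp derivD derivX derivC addr0 mulr1.
by rewrite -!comp_polyM -comp_polyD bez comp_polyC.
Qed.

Lemma horner_spec_shift (c x w : R[i]) Q :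
  (spec x (Q \Po ('X + c%:P%:P))).[w] = (spec x Q).[c + w].
Proof.
by rewrite spec_comp rmorphD /= specX specC hornerC horner_comp !hornerE addrC.
Qed.

Lemma ccontinuous_at_affine (c : R[i]) (g : R -> R[i]) t :
  ccontinuous_at g t -> ccontinuous_at (fun x => x%:C * (c + g x)) t.
Proof.
move=> ctg e e0; pose K := `|t| + 1 + cabs (c + g t).
have K0 : 0 < K by rewrite ltr_pwDl ?cabs_ge0 ?ltr_wpDl.
have [d d0 Hd] := ctg (e / 2 / K) (divr_gt0 (divr_gt0 e0 (ltr0Sn _ 1)) K0).
exists (Num.min d (Num.min 1 (e / 2 / K))) => [|s].
  by rewrite !lt_min d0 ltr01 !divr_gt0.
rewrite !lt_min => /and3P[/Hd lt_g lt1 lt2].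
have -> : s%:C * (c + g s) - t%:C * (c + g t) =
    s%:C * (g s - g t) + (s - t)%:C * (c + g t) by rewrite rmorphB; ring.
rewrite (le_lt_trans (cabsD _ _)) // !cabsM !cabs_real.
have sK : `|s| <= `|t| + 1.
  by have := ler_normD (s - t) t; rewrite subrK; move: lt1; clear; lra.
have ek0 : 0 <= e / 2 / K by rewrite ltW // !divr_gt0.
have le1 := ler_pM (normr_ge0 s) (cabs_ge0 _) sK (ltW lt_g).
have le2 := ler_wpM2r (cabs_ge0 (c + g t)) (ltW lt2).
have eK : (e / 2 / K) * K = e / 2 by rewrite divfK ?gt_eqF.
rewrite {2}/K mulrDr [_ * (`|t| + 1)]mulrC in eK.
by clear - e0 le1 le2 eK; lra.
Qed.

Lemma analytic_at_affine (c : R[i]) (g : R -> R[i]) :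
  analytic_at g 0 -> analytic_at (fun x => x%:C * (c + g x)) 0.
Proof.
move=> [g1 g2]; split.
  under eq_fun do rewrite Re_realM ReD.
  exact/real_analytic_at_mulX/real_analytic_at_addl.
under eq_fun do rewrite Im_realM ImD.
exact/real_analytic_at_mulX/real_analytic_at_addl.
Qed.

(** The identity C + x^k (x (c + w)) = (C + c x^(k+1)) + x^(k+1) w carries the condition over;
    restricting to |w| < 1 keeps x (c + w) small. *)
Lemma roots_on_circle_blowup C k n Q c : roots_on_circle C k Q -> weight_ge 1 1 n Q ->
  roots_on_circle (C + c *: 'X^(k.+1)) k.+1
    (weighted_blowup 1 1 n 1 Q \Po ('X + c%:P%:P)).
Proof.
move=> [e e0 circ] wQ; have c0 : 0 < cabs c + 1 by rewrite ltr_wpDl ?cabs_ge0.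
exists (Num.min 1 (Num.min e (e / (cabs c + 1)))).
  by rewrite !lt_min ltr01 e0 divr_gt0.
move=> x w x0; rewrite !lt_min => /and3P[_ xe xec] /and3P[w1 _ _].
rewrite horner_spec_shift => rootw.
have -> : (C + c *: 'X^(k.+1)).[x%:C] + x%:C ^+ k.+1 * w =
          C.[x%:C] + x%:C ^+ k * (x%:C * (c + w)).
  by rewrite hornerD hornerZ hornerXn exprSr; ring.
apply: circ => //.
  rewrite cabsM cabs_real (@le_lt_trans _ _ (`|x| * (cabs c + 1))) ?ler_wpM2l //.
    by rewrite (le_trans (cabsD _ _)) // lerD2l ltW.
  by rewrite -ltr_pdivlMr.
have := horner_weighted_blowup 1 x%:C (c + w) wQ.
by rewrite rootw mulr0 mul1r !expr1.
Qed.

(** The branches of Q are x (c + g(x)), with c a root of the initial form and g a branch of the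
    blow-up at c. None is missed, since [roots_near_tangents] puts w / x close to some c. *)
Lemma has_branches_blowup n Q : weight_ge 1 1 n Q -> (Q`_n).[0] != 0 ->
  let Q1 := weighted_blowup 1 1 n 1 Q in
  (forall c, (spec 0 Q1).[c] = 0 -> has_branches (Q1 \Po ('X + c%:P%:P))) ->
  has_branches Q.
Proof.
move=> wQ An Q1 brQ1; have [szE leadE] := size_initial_form wQ An.
have [rs Ers] := closed_field_poly_normal (spec 0 Q1); rewrite leadE in Ers.
have root_rs c : ((spec 0 Q1).[c] == 0) = (c \in rs).
  by rewrite Ers hornerZ mulf_eq0 (negPf An) /= -rootE root_prod_XsubC.
have QQ1 x w : (spec x Q).[x * w] = x ^+ n * (spec x Q1).[w].
  by have := horner_weighted_blowup 1 x w wQ; rewrite mul1r !expr1.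
(* Induction on the list of tangents merges the branches over all c and takes the least radius. *)
have [fs [e [e0 fsP rootP]]] : exists (fs : seq (R -> R[i])) (e : R),
  [/\ 0 < e,
      forall f, f \in fs -> [/\ f 0 = 0, analytic_at f 0,
        forall x, `|x| < e -> ccontinuous_at f x &
        forall x, x != 0 -> `|x| < e -> (spec x%:C Q).[f x] = 0] &
      forall c (x : R) w, c \in rs -> x != 0 -> `|x| < e -> cabs w < e ->
        (spec x%:C Q1).[c + w] = 0 ->
        exists2 f, f \in fs & x%:C * (c + w) = f x].
  have {root_rs} : forall c, c \in rs -> has_branches (Q1 \Po ('X + c%:P%:P)).
    by move=> c; rewrite -root_rs => /eqP; apply: brQ1.
  elim: rs {Ers} => [_|c rs IH brs]; first by exists [::], 1.
  have [|fs [e [e0 fsP rootP]]] := IH; first by move=> y yrs; apply: brs; rewrite inE yrs orbT.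
  have [gs [e' [e'0 gsP rootP']]] := brs c (mem_head _ _).
  pose lift (g : R -> R[i]) := fun x : R => x%:C * (c + g x).
  exists (map lift gs ++ fs), (Num.min e e'); split.
  - by rewrite lt_min e0.
  - move=> f; rewrite mem_cat => /orP[/mapP[g /gsP[g0 an ct rt] ->]|/fsP[f0 an ct rt]]; split=> //.
    + by rewrite /lift mul0r.
    + exact: analytic_at_affine.
    + by move=> x; rewrite lt_min => /andP[_ /ct]; apply: ccontinuous_at_affine.
    + move=> x x0; rewrite lt_min => /andP[_ xe].
      by rewrite /lift QQ1 -horner_spec_shift rt ?mulr0.
    + by move=> x; rewrite lt_min => /andP[/ct].
    + by move=> x x0; rewrite lt_min => /andP[xe _]; apply: rt.
  - move=> y x w; rewrite inE !lt_min => /orP[/eqP ->|yrs] x0 /andP[x1 x2] /andP[w1 w2] Qw.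
      have [|g ggs ->] := rootP' x w x0 x2 w2; first by rewrite horner_spec_shift.
      by exists (lift g); rewrite // mem_cat map_f.
    have [f ffs ->] := rootP y x w yrs x0 x1 w1 Qw.
    by exists f; rewrite // mem_cat ffs orbT.
have [d d0 near] := roots_near_tangents wQ An e0.
exists fs, (Num.min e d); split=> //.
- by rewrite lt_min e0.
- move=> f /fsP[f0 an ct rt]; split=> //.
  + by move=> x; rewrite lt_min => /andP[/ct].
  + by move=> x x0; rewrite lt_min => /andP[xe _]; apply: rt.
- move=> x w x0; rewrite !lt_min => /andP[xe xd] /andP[_ wd] Qw.
  have xC0 : x%:C != 0 by rewrite -cabs_eq0 cabs_real normr_eq0.
  have wE : w = x%:C * (w / x%:C) by rewrite mulrC divfK.
  have Q1w : (spec x%:C Q1).[w / x%:C] = 0.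
    by move/eqP: Qw; rewrite {1}wE QQ1 mulf_eq0 expf_eq0 (negPf xC0) andbF => /eqP.
  have xd' : cabs x%:C < d by rewrite cabs_real.
  have wd' : cabs (x%:C * (w / x%:C)) < d by rewrite -wE.
  have [c rc lt_c] := near x%:C (w / x%:C) xC0 xd' wd' Q1w.
  rewrite wE -[w / _](subrKC c); apply: rootP => //; last by rewrite subrKC.
  by rewrite -root_rs rc.
Qed.

(** The induction on the size of D generalises C, k, Q and the cofactors, since passing to a tangent
    changes all of them. *)
Lemma hyperbolic_branches C k Q (A B : {poly {poly R[i]}}) D :
  D != 0 -> A * Q + B * Q^`() = D%:P -> spec 0 Q != 0 -> C.[0] != 0 ->
  roots_on_circle C k Q -> has_branches Q.
Proof.
elim: {D}_.+1 {-2}D (ltnSn (size D)) C k Q A B => // N IHN D szD C k Q A B D0 bez Q0 C0 circ.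
have [n An low] : exists2 n, (Q`_n).[0] != 0 & forall j, (j < n)%N -> (Q`_j).[0] = 0.
  have exn : exists n, (Q`_n).[0] != 0.
    by exists (size (spec 0 Q)).-1; rewrite -coef_spec -lead_coefE lead_coef_eq0.
  case: (ex_minnP exn) => n An minn; exists n => // j; rewrite ltnNge => ltj.
  by apply/eqP; apply: contraNT ltj => /minn.
have wQ := hyperbolic_order circ C0 low An.
have [n1|n1] := eqVneq n 1%N.
  rewrite {}n1 in An low.
  have [||f [e [e0 f0 an ct fP]]] := @implicit_function R Q.
  - by rewrite horner_coef0 coef_spec low.
  - by rewrite horner_coef0 coef_deriv mulr1n coef_spec.
  exists [:: f], e; split=> //.
    move=> g; rewrite inE => /eqP ->; split=> // x _ xe.
    exact: (fP x xe).1.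
  move=> x w _ xe we Qw; exists f; rewrite ?mem_head //.
  exact: (fP x xe).2.
apply: (has_branches_blowup wQ An) => c rc.
have [szE _] := size_initial_form wQ An.
(* For n = 0 the initial form is a nonzero constant and has no root c; n = 1 is settled above. So D
   loses at least one factor x. *)
have n2 : (1 < n)%N.
  case: n n1 {An low wQ} szE rc => [|[|n]] // _ /eqP/size_poly1P[a a0 ->].
  by rewrite hornerC => a00; rewrite a00 eqxx in a0.
have QE : Q \Po ('X%:P * 'X) = 'X^n *: weighted_blowup 1 1 n 1 Q.
  apply: spec_inj => x z; have := horner_weighted_blowup 1 x z wQ.
  rewrite mul1r !expr1 spec_comp rmorphM /= specX specC hornerX horner_comp.
  rewrite -mul_polyC rmorphM /= specC hornerM !hornerE.
  by move=> <-.
have [A1 [B1 [D1 [bez1 D10 DE]]]] := bezout_blowup (ltnW n2) D0 bez QE.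
apply: (IHN D1 _ (C + c *: 'X^(k.+1)) k.+1 _ _ _ D10 (bezout_shift c bez1)).
- rewrite -ltnS (leq_trans _ szD) // ltnS DE size_monicM ?monicXn // size_polyXn.
  by rewrite addSn /= -[X in (X < _)%N]add0n ltn_add2r -ltnS prednK // ltnW.
- rewrite spec_comp rmorphD /= specX specC hornerC comp_poly2_eq0 ?size_XaddC //.
  by rewrite -size_poly_gt0 szE.
- by rewrite hornerD hornerZ hornerXn expr0n mulr0 addr0.
- exact: roots_on_circle_blowup.
Qed.

End Branches.

(** * Reduction to a squarefree germ *)

Section Reduction.
Variable R : realType.
Implicit Types (Q S : {poly {poly R[i]}}) (p q : {poly R[i]}).

(** If s(y) <> 0, the full power (X - y)^m dividing q divides g, hence q'; but y has multiplicity
    only m - 1 in q'. *)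
Lemma root_squarefree_part q (s g h : {poly R[i]}) (a b y : R[i]) : a != 0 -> b != 0 ->
  q != 0 -> a *: q = s * g -> b *: q^`() = h * g -> q.[y] = 0 -> s.[y] = 0.
Proof.
move=> a0 b0 q0 sg hg qy; apply/eqP; apply: contraT => sy.
have [m [r]] := multiplicity_XsubC q y; rewrite q0 /= => ry qE.
have m0 : (0 < m)%N.
  rewrite lt0n; apply: contraNneq ry => m0.
  by rewrite rootE -qy qE m0 expr0 mulr1.
have dvg : ('X - y%:P) ^+ m %| g.
  have cop : coprimep (('X - y%:P) ^+ m) s.
    by rewrite coprimep_expl // coprimep_sym coprimep_XsubC rootE.
  by rewrite -(Gauss_dvdpr _ cop) -sg dvdpZr // qE dvdp_mull.
have : ('X - y%:P) ^+ m %| q^`() by rewrite -(dvdpZr _ _ b0) hg dvdp_mull.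
rewrite qE derivM deriv_exp derivXsubC mul1r (dvdp_addr _ (dvdp_mull _ (dvdpp _))).
rewrite mulrnAr -mulrnAl -{1}(prednK m0) exprS.
rewrite dvdp_mul2r ?expf_neq0 ?polyXsubC_eq0 // dvdp_XsubCl rootE hornerMn.
by rewrite mulrn_eq0 gtn_eqF //= -rootE (negPf ry).
Qed.

(** S is the quotient of Q by its gcd g with Q_w. Pseudo-division over C[x] yields the
    factorizations up to powers of the leading coefficient of g, so roots are compared where L, its
    product with that of Q, does not vanish. *)
Lemma squarefree_part Q : Q != 0 -> exists (S A B : {poly {poly R[i]}}) (D L : {poly R[i]}),
  [/\ D != 0, L != 0, A * S + B * S^`() = D%:P, S != 0 &
   forall x y, L.[x] != 0 -> (spec x Q).[y] = 0 <-> (spec x S).[y] = 0].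
Proof.
move=> Q0; pose g := gcdp Q Q^`(); pose S := Q %/ g.
have sepS : separable_poly S by apply: make_separable.
have S0 := separable_poly_neq0 sepS.
have g0 : g != 0 by rewrite gcdp_eq0 (negPf Q0).
have QE := Pdiv.Idomain.divpK (dvdp_gcdl Q Q^`()).
have Q'E := Pdiv.Idomain.divpK (dvdp_gcdr Q Q^`()).
rewrite -/g -/S in QE Q'E; set a := scalp _ _ in QE; set b := scalp _ _ in Q'E.
have : coprimep S S^`() by move: sepS; rewrite unlock.
move=> /Bezout_coprimepP[[u v] /= /eqpP[[c1 c2] /= /andP[c10 c20] bez]].
exists S, (c1 *: u), (c1 *: v), c2, (lead_coef g * lead_coef Q).
split; rewrite ?mulf_neq0 ?lead_coef_eq0 //.
  by rewrite -!scalerAl -scalerDr bez -mul_polyC mulr1.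
move=> x y; rewrite hornerM mulf_eq0 negb_or => /andP[lgx lQx].
have evE n (P : {poly {poly R[i]}}) :
    spec x (lead_coef g ^+ n *: P) = (lead_coef g).[x] ^+ n *: spec x P.
  by rewrite -mul_polyC rmorphM /= specC horner_exp mul_polyC.
have {}QE := congr1 (fun P => spec x P) QE; rewrite rmorphM /= evE in QE.
have {}Q'E := congr1 (fun P => spec x P) Q'E; rewrite rmorphM /= evE spec_deriv in Q'E.
have lx n : (lead_coef g).[x] ^+ n != 0 by rewrite expf_neq0.
split=> rt.
  apply: (root_squarefree_part (lx a) (lx b) _ (esym QE) (esym Q'E) rt) => //.
  by apply: contraNneq lQx => Qx0; rewrite lead_coefE -coef_spec Qx0 coef0.
have := congr1 (horner^~ y) QE; rewrite hornerM hornerZ rt mul0r => /esym/eqP.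
by rewrite mulf_eq0 (negPf (lx a)) /= => /eqP.
Qed.

(** Each division by x lowers the degree of the leading coefficient, so the process stops. *)
Lemma split_content S : S != 0 ->
  exists (e : nat) S0, S = 'X^e *: S0 /\ spec 0 S0 != 0.
Proof.
elim: {S}_.+1 {-2}S (ltnSn (size (lead_coef S))) => // N IHN S szS Sn0.
have [Sx0|] := eqVneq (spec 0 S) 0; last by exists 0%N, S; rewrite expr0 scale1r.
pose S1 := \poly_(k < size S) (S`_k %/ 'X).
have SE : S = 'X *: S1.
  apply/polyP => k; rewrite coefZ coef_poly; case: ltnP => [_|lek]; last first.
    by rewrite nth_default // mulr0.
  rewrite mulrC divpK // -[X in X %| _]subr0 -polyC0 dvdp_XsubCl rootE.
  by rewrite -coef_spec Sx0 coef0.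
have S10 : S1 != 0 by apply: contraNneq Sn0 => z; rewrite SE z scaler0.
have [|e [S0 [S1E S00]]] := IHN S1 _ S10.
  rewrite -ltnS (leq_trans _ szS) // ltnS SE -mul_polyC lead_coefM lead_coefC.
  by rewrite mulrC size_mulX // lead_coef_eq0.
by exists e.+1, S0; rewrite SE {1}S1E scalerA -exprS.
Qed.

Lemma nonzero_near0 p : p != 0 -> exists2 d : R, 0 < d &
  forall x, x != 0 -> cabs x < d -> p.[x] != 0.
Proof.
move=> p0; have [m [q]] := multiplicity_XsubC p 0; rewrite p0 /= rootE => q0 pE.
have q00 : 0 < cabs q.[0] by rewrite cabs_gt0.
have [d d0 cont] := horner_continuous_at q 0 q00.
exists d => // x x0 xd; have qx : q.[x] != 0.
  have := cont x; rewrite subr0 => /(_ xd); apply: contraTneq => ->.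
  by rewrite sub0r cabsN ltxx.
by rewrite pE hornerM horner_exp hornerXsubC subr0 mulf_neq0 // expf_neq0.
Qed.

End Reduction.

(** * The Cayley coordinate and unimodularity of the roots *)

Section CayleyCoordinate.
Variable R : realType.
Implicit Types (r : {poly {poly R[i]}}) (z : R[i]).

(** For x = tan(theta / 2) this is e^(i theta): a rational parametrization of the circle minus -1 by
    the real line, with 0 sent to 1. *)
Definition cayley (x : R[i]) : R[i] := (1 + 'i%C * x) / (1 - 'i%C * x).

Lemma cayley_denom_neq0 (x : R) : 1 - 'i%C * x%:C != 0.
Proof.
have Re1 : complex.Re (1 - 'i%C * x%:C) = 1 by rewrite /=; ring.
by apply: contra_eq_neq Re1 => ->; rewrite /= eq_sym oner_eq0.
Qed.

Lemma cabs_cayley (x : R) : cabs (cayley x%:C) = 1.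
Proof.
have d0 := cayley_denom_neq0 x.
rewrite /cayley cabsM cabsV; apply: (mulIf (_ : cabs (1 - 'i%C * x%:C) != 0)).
  by rewrite cabs_eq0.
rewrite divfK ?cabs_eq0 // mul1r.
apply/eqP; rewrite -(eqrXn2 (n := 2)) ?cabs_ge0 // !sqr_cabs /=; apply/eqP.
ring.
Qed.

Lemma cayley_sqr (x : R) : complex.Re (cayley x%:C) = (1 - x ^+ 2) / (1 + x ^+ 2) /\
  complex.Im (cayley x%:C) = 2 * x / (1 + x ^+ 2).
Proof.
have d0 : 1 + x ^+ 2 != 0 by rewrite gt_eqF // ltr_wpDr ?sqr_ge0.
have -> : cayley x%:C = Complex ((1 - x ^+ 2) / (1 + x ^+ 2)) (2 * x / (1 + x ^+ 2)).
  apply: (mulIf (cayley_denom_neq0 x)); rewrite /cayley divfK ?cayley_denom_neq0 //.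
  by apply/eqP; rewrite eq_complex /=; apply/andP; split; apply/eqP; field.
by [].
Qed.

Lemma symmetric_root r z1 z2 : essentially_T2_symmetric r -> z1 != 0 -> z2 != 0 ->
  r.[z1, z2] = 0 -> r.[(conjc z1)^-1, (conjc z2)^-1] = 0.
Proof.
move=> [lam lam1 symr] z10 z20 rz; have := horner_reflection r z10 z20.
rewrite symr hornerZ hornerM hornerC rz mulr0 => /esym/eqP.
rewrite !mulf_eq0 !expf_eq0 (negPf z10) (negPf z20) !andbF /= conjC_eq0 => /eqP.
by [].
Qed.

(* A zero at a point of T x D, or of T x (C \ closed D) after reflection, would
   persist at nearby points of the bidisk. *)
Lemma unimodular_roots r z1 z2 : essentially_T2_symmetric r ->
  zero_set r `&` @bidisk R = set0 -> cabs z1 = 1 -> r.[z1%:P] != 0 ->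
  r.[z1, z2] = 0 -> cabs z2 = 1.
Proof.
move=> symr norootD z11 rz1 rz.
have ltC1 (a : R) : (a%:C < 1 :> R[i]) = (a < 1) by exact: (ltcR a 1).
have inside w : cabs w < 1 -> r.[z1, w] != 0.
  move=> w1; apply/eqP => rw.
  rewrite horner_polyC in rz1 rw.
  have e0 : 0 < 1 - cabs w by rewrite subr_gt0.
  have [d d0 Hd] := root_continuity rz1 rw e0.
  pose t : R := Num.min (1 / 2) (d / 2).
  have t0 : 0 < t by rewrite lt_min !divr_gt0.
  have t1 : t <= 1 / 2 by rewrite ge_min lexx.
  have td : t <= d / 2 by rewrite ge_min lexx orbT.
  have [|y yw ry] := Hd ((1 - t)%:C * z1).
    have -> : (1 - t)%:C * z1 - z1 = (- t)%:C * z1.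
      by rewrite rmorphB rmorphN rmorph1; ring.
    rewrite cabsM z11 mulr1 cabs_real normrN gtr0_norm //.
    by clear - td d0; lra.
  have : (zero_set r `&` @bidisk R) ((1 - t)%:C * z1, y).
    split; first by rewrite /zero_set /= horner_polyC.
    rewrite /bidisk /= !normcE_cabs cabsM z11 mulr1 cabs_real.
    rewrite !ltC1 ger0_norm; last by clear - t1; lra.
    split; first by clear - t0; lra.
    by have := cabsD (y - w) w; rewrite subrK; clear - yw; lra.
  by rewrite norootD.
have z10 : z1 != 0 by rewrite -cabs_eq0 z11 oner_eq0.
have [lt1|lt1|//] := ltgtP (cabs z2) 1.
  by have := inside _ lt1; rewrite rz eqxx.
have z20 : z2 != 0 by rewrite -cabs_gt0 (lt_trans _ lt1).
have := symmetric_root symr z10 z20 rz.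
have -> : (conjc z1)^-1 = z1.
  apply: (mulIf (_ : conjc z1 != 0)); first by rewrite -cabs_eq0 cabs_conjc z11 oner_eq0.
  rewrite mulVf -?cabs_eq0 ?cabs_conjc ?z11 ?oner_eq0 //.
  by rewrite -sqr_normc normcE_cabs z11 expr1n.
move/eqP; apply: contraTeq => _; apply: inside.
by rewrite cabsV cabs_conjc invf_lt1 // (lt_trans _ lt1).
Qed.

End CayleyCoordinate.

(** * Branches of the variety at a point of the torus *)

Section LocalStructure.
Variable R : realType.
Implicit Types (r : {poly {poly R[i]}}) (z : R[i]).

(* (1 - i x)^(size r) r(p1 cayley(x), p2 + w) as a polynomial in (x, w). *)
Definition cayley_pullback r (p1 p2 : R[i]) : {poly {poly R[i]}} :=
  (\poly_(k < size (swapXY r)) \sum_(j < (size r).+1)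
     (((swapXY r)`_k)`_j * p1 ^+ j) *:
       ((1 + 'i%C *: 'X) ^+ j * (1 - 'i%C *: 'X) ^+ (size r - j)))
  \Po ('X + p2%:P%:P).

Lemma horner_cayley_pullback r p1 p2 x w : 1 - 'i%C * x != 0 ->
  (spec x (cayley_pullback r p1 p2)).[w] =
  (1 - 'i%C * x) ^+ size r * r.[p1 * cayley x, p2 + w].
Proof.
move=> d0; rewrite /cayley_pullback horner_spec_shift horner_polyC.
rewrite (horner_coef_wide _ (leq_trans (size_spec _ _) (size_poly _ _))).
rewrite (horner_coef_wide _ (size_spec _ (swapXY r))) mulr_sumr.
apply: eq_bigr => k _; rewrite !coef_spec coef_poly ltn_ord mulrA; congr (_ * _).
have szk : (size ((swapXY r)`_k)%R <= (size r).+1)%N.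
  by have := max_size_coefXY (swapXY r) k; rewrite sizeYE swapXYK => /leqW.
rewrite horner_sum (horner_coef_wide _ szk) mulr_sumr; apply: eq_bigr => j _.
rewrite hornerZ hornerM !horner_exp !hornerD hornerN !hornerZ !hornerC !hornerX.
have jr : (j <= size r)%N by rewrite -ltnS.
have alg (c a b e f : R[i]) : f != 0 -> c * a * (b * e) = e * f * (c * (a * (b / f))).
  by move=> f0; field.
rewrite -[X in _ = _ ^+ X * _](subnK jr) exprD exprMn expr_div_n.
by apply: alg; rewrite expf_neq0.
Qed.

(** At x = i the Cayley map vanishes, so the point (i, -p2) lies over the origin. *)
Lemma cayley_pullback_neq0 r p1 p2 : r.[0, 0] != 0 -> cayley_pullback r p1 p2 != 0.
Proof.
move=> r00; apply: contraNneq r00 => Q0.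
have d2 : 1 - 'i%C * 'i%C = 2 :> R[i].
  by apply/eqP; rewrite eq_complex /=; apply/andP; split; apply/eqP; ring.
have d0 : 1 - 'i%C * 'i%C != 0 :> R[i] by rewrite d2 pnatr_eq0.
have := @horner_cayley_pullback r p1 p2 'i%C (- p2) d0.
have -> : cayley ('i%C : R[i]) = 0.
  rewrite /cayley (_ : 1 + _ = 0) ?mul0r //.
  by apply/eqP; rewrite eq_complex /=; apply/andP; split; apply/eqP; ring.
rewrite Q0 rmorph0 horner0 mulr0 subrr => /esym/eqP.
by rewrite mulf_eq0 expf_eq0 (negPf d0) andbF.
Qed.

(** The final alternative treats the slice x = 0, which the branches do not control: it is a whole
    curve, or else p2 is isolated on it, and then the nonempty list of branches accounts for the
    point p. *)
Lemma local_structure r (p1 p2 : R[i]) : essentially_T2_symmetric r ->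
  zero_set r `&` @bidisk R = set0 -> cabs p1 = 1 -> cabs p2 = 1 -> r.[p1, p2] = 0 ->
  exists (fs : seq (R -> R[i])) (e : R),
  [/\ 0 < e,
      forall f, f \in fs -> f 0 = 0 /\
        forall t, `|t| < e -> ccontinuous_at f t /\ analytic_at f t,
      forall (x : R) w, x != 0 -> `|x| < e -> cabs w < e ->
        r.[p1 * cayley x%:C, p2 + w] = 0 -> exists2 f, f \in fs & w = f x,
      forall (x : R) f, x != 0 -> `|x| < e -> f \in fs ->
        r.[p1 * cayley x%:C, p2 + f x] = 0 /\ cabs (p2 + f x) = 1 &
      r.[p1%:P] = 0 \/
      fs <> [::] /\ forall w, cabs w < e -> r.[p1, p2 + w] = 0 -> w = 0].
Proof.
move=> symr norootD p11 p21 rp; pose Q := cayley_pullback r p1 p2.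
have r00 : r.[0, 0] != 0.
  apply/eqP => r0; have : (zero_set r `&` @bidisk R) (0, 0).
    by split=> //; split; rewrite /= normr0 ltr01.
  by rewrite norootD.
have Q_neq0 : Q != 0 by apply: cayley_pullback_neq0.
have QP (x : R) w : ((spec x%:C Q).[w] = 0) <-> (r.[p1 * cayley x%:C, p2 + w] = 0).
  rewrite horner_cayley_pullback ?cayley_denom_neq0 //; split=> [/eqP|->]; last by rewrite mulr0.
  by rewrite mulf_eq0 expf_eq0 (negPf (cayley_denom_neq0 x)) andbF => /eqP.
have cayley0 : cayley (0%:C : R[i]) = 1 by rewrite /cayley mulr0 addr0 subr0 divr1.
have QP0 w : ((spec 0 Q).[w] = 0) <-> (r.[p1, p2 + w] = 0).
  by have := QP 0 w; rewrite cayley0 mulr1.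
have [a [Q1 [QE Q10]]] := split_content Q_neq0.
have Q1_neq0 : Q1 != 0 by apply: contraNneq Q10 => ->; rewrite rmorph0.
have QQ1 (x : R[i]) w : x != 0 -> (spec x Q).[w] = 0 <-> (spec x Q1).[w] = 0.
  move=> x0; rewrite QE -mul_polyC rmorphM /= specC hornerXn hornerM hornerC.
  split=> [/eqP|->]; last by rewrite mulr0.
  by rewrite mulf_eq0 expf_eq0 (negPf x0) andbF => /eqP.
have [S [A [B [D [L [D0 L0 bez S_neq0 Q1S]]]]]] := squarefree_part Q1_neq0.
(* The squarefree part may again contain a power of x, so the content is split a second time. *)
have [b [S0 [SE S00]]] := split_content S_neq0.
have SS0 (x : R[i]) w : x != 0 -> (spec x S).[w] = 0 <-> (spec x S0).[w] = 0.
  move=> x0; rewrite SE -mul_polyC rmorphM /= specC hornerXn hornerM hornerC.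
  split=> [/eqP|->]; last by rewrite mulr0.
  by rewrite mulf_eq0 expf_eq0 (negPf x0) andbF => /eqP.
have bez0 : ('X^b *: A) * S0 + ('X^b *: B) * S0^`() = D%:P.
  by rewrite -bez SE derivZ -!scalerAl -!scalerAr.
have G_neq0 : L * lead_coef Q * D != 0 by rewrite !mulf_neq0 ?lead_coef_eq0.
have [d d0 Gx] := nonzero_near0 G_neq0.
have generic (x : R) : x != 0 -> `|x| < d ->
    [/\ x%:C != 0, L.[x%:C] != 0, spec x%:C Q != 0 & D.[x%:C] != 0].
  move=> x0 xd; have xC0 : x%:C != 0 by rewrite -cabs_eq0 cabs_real normr_eq0.
  have := Gx x%:C xC0; rewrite cabs_real => /(_ xd); rewrite !hornerM !mulf_eq0 !negb_or.
  move=> /andP[/andP[Lx Qx] Dx]; split=> //.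
  by apply: contraNneq Qx => Qx0; rewrite lead_coefE -coef_spec Qx0 coef0.
have QS0 (x : R) w : x != 0 -> `|x| < d ->
    r.[p1 * cayley x%:C, p2 + w] = 0 <-> (spec x%:C S0).[w] = 0.
  move=> x0 xd; have [xC0 Lx _ _] := generic x x0 xd.
  by rewrite -QP QQ1 // Q1S // SS0.
have onT (x : R) w : x != 0 -> `|x| < d ->
    r.[p1 * cayley x%:C, p2 + w] = 0 -> cabs (p2 + w) = 1.
  move=> x0 xd rw; have [xC0 _ Qx _] := generic x x0 xd.
  apply: (unimodular_roots symr norootD _ _ rw).
    by rewrite cabsM p11 cabs_cayley mulr1.
  apply: contraNneq Qx => rx; apply/eqP/horner_inj => z.
  by rewrite horner0 QP rx horner0.
have circ : roots_on_circle p2%:P 0 S0.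
  exists d => // x w x0 xd _ /(QS0 x w x0 xd) rw.
  by rewrite hornerC expr0 mul1r; apply: onT rw.
have [|fs [e [e0 fsP rootP]]] := hyperbolic_branches D0 bez0 S00 _ circ.
  by rewrite hornerC -cabs_eq0 p21 oner_eq0.
(* At t <> 0 the value f(t) is a simple root of S0: a double root would give D(t) = 0. *)
have an_fs f t : f \in fs -> `|t| < Num.min d e -> analytic_at f t.
  rewrite lt_min => /fsP[f0 an ct rt] /andP[td te].
  have [->//|t0] := eqVneq t 0.
  have [_ _ _ Dt] := generic t t0 td.
  apply: (@analytic_simple_root R S0) => //; first exact: ct.
    have e't : 0 < Num.min `|t| (e - `|t|) by rewrite lt_min normr_gt0 t0 subr_gt0.
    apply/near_normP; exists (Num.min `|t| (e - `|t|)) => // s.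
    rewrite lt_min => /andP[st ste]; apply: rt.
      by apply: contraTneq st => ->; rewrite sub0r normrN ltxx.
    by have := ler_normD (s - t) t; rewrite subrK; move: ste; clear; lra.
  apply: contraNneq Dt => S't.
  have := congr1 (fun P => (spec t%:C P).[f t]) bez0.
  rewrite specC hornerC rmorphD !rmorphM /= hornerD !hornerM spec_deriv.
  by rewrite (rt t t0 te) S't !mulr0 addr0 => <-.
pose e1 := Num.min d e.
have e10 : 0 < e1 by rewrite lt_min d0.
have branch (x : R) w : x != 0 -> `|x| < e1 -> cabs w < e1 ->
    r.[p1 * cayley x%:C, p2 + w] = 0 -> exists2 f, f \in fs & w = f x.
  move=> x0; rewrite !lt_min => /andP[xd xe] /andP[_ we] /(QS0 x w x0 xd).
  exact: rootP.
have onV (x : R) f : x != 0 -> `|x| < e1 -> f \in fs ->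
    r.[p1 * cayley x%:C, p2 + f x] = 0 /\ cabs (p2 + f x) = 1.
  move=> x0; rewrite lt_min => /andP[xd xe] /fsP[_ _ _ rt].
  by have rf := (QS0 x (f x) x0 xd).2 (rt x x0 xe); split=> //; apply: onT rf.
have fsP1 f : f \in fs -> f 0 = 0 /\
    forall t, `|t| < e1 -> ccontinuous_at f t /\ analytic_at f t.
  move=> ffs; have [f0 _ ct _] := fsP f ffs; split=> // t te1; split.
    by apply: ct; move: te1; rewrite lt_min => /andP[].
  exact: an_fs.
clearbody e1; have [rp10|rp10] := eqVneq r.[p1%:P] 0.
  by exists fs, e1; split=> //; left.
have Qs0 : spec 0 Q != 0.
  apply: contraNneq rp10 => Qs; apply/eqP/horner_inj => z; rewrite horner0.
  by have := (QP0 (z - p2)).1; rewrite Qs horner0 subrKC => ->.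
have [d2 d20 isol] := nonzero_near0 Qs0.
exists fs, (Num.min e1 d2); split.
- by rewrite lt_min e10.
- move=> f /fsP1[f0 ct]; split=> // t; rewrite lt_min => /andP[/ct].
  by [].
- by move=> x w x0; rewrite !lt_min => /andP[xe _] /andP[we _]; apply: branch.
- by move=> x f x0; rewrite lt_min => /andP[xe _]; apply: onV.
- right; split.
    (* Root continuity at w = 0 gives a small root for some x > 0, which must lie on a branch. *)
    have Q00 : (spec 0 Q).[0] = 0 by apply/QP0; rewrite addr0.
    have [d3 d30 near] := root_continuity Qs0 Q00 e10.
    pose x : R := Num.min (d3 / 2) (e1 / 2).
    have x0 : 0 < x by rewrite lt_min !divr_gt0.
    have xd3 : x <= d3 / 2 by rewrite ge_min lexx.
    have xe1 : x <= e1 / 2 by rewrite ge_min lexx orbT.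
    have [|w we rw] := near x%:C.
      by rewrite subr0 cabs_real gtr0_norm //; clear - xd3 d30; lra.
    rewrite subr0 in we; have [||f ffs _] := branch x w _ _ we ((QP x w).1 rw).
    + by rewrite gt_eqF.
    + by rewrite gtr0_norm //; clear - xe1 e10; lra.
    + by move=> fs0; rewrite fs0 in ffs.
  move=> w; rewrite lt_min => /andP[_ wd] /QP0 rw; apply/eqP.
  by apply: contraT => w0; have := isol w w0 wd; rewrite rw eqxx.
Qed.

End LocalStructure.

(** * Analytic curves in the torus *)

Section TorusCurves.
Variable R : realType.
Implicit Types (p z : R[i]) (t e : R).

(** If z / p = e^(i theta) with |p| = 1, [re_coord] is cos theta and [tan_coord] is tan(theta / 2) =
    sin theta / (1 + cos theta). *)
Definition re_coord p z : R := complex.Re (conjc p * z).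
Definition tan_coord p z : R :=
  complex.Im (conjc p * z) / (1 + complex.Re (conjc p * z)).

Lemma conjc_mul_unit p z : cabs p = 1 -> conjc p * (p * z) = z.
Proof.
by move=> p1; rewrite mulrA [conjc p * p]mulrC -sqr_normc normcE_cabs p1 expr1n mul1r.
Qed.

Lemma re_coord_cayley p t : cabs p = 1 ->
  re_coord p (p * cayley t%:C) = (1 - t ^+ 2) / (1 + t ^+ 2).
Proof. by move=> p1; rewrite /re_coord conjc_mul_unit // (cayley_sqr t).1. Qed.

Lemma onep_sqr_gt0 t : 0 < 1 + t ^+ 2.
Proof. by rewrite ltr_wpDr ?sqr_ge0. Qed.

Lemma tan_coord_cayley p t : cabs p = 1 -> tan_coord p (p * cayley t%:C) = t.
Proof.
move=> p1; rewrite /tan_coord conjc_mul_unit // (cayley_sqr t).1 (cayley_sqr t).2.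
have d0 : 1 + t ^+ 2 != 0 by rewrite gt_eqF ?onep_sqr_gt0.
have -> : 1 + (1 - t ^+ 2) / (1 + t ^+ 2) = 2 / (1 + t ^+ 2) by field.
by field; rewrite d0.
Qed.

(** This is the cosine at Cayley parameter e. It decreases in |e|, so |t| < e becomes an open
    condition on [re_coord]. *)
Definition re_min e : R := (1 - e ^+ 2) / (1 + e ^+ 2).

Lemma re_min_lt1 e : 0 < e -> re_min e < 1.
Proof.
move=> e0; rewrite /re_min ltr_pdivrMr ?onep_sqr_gt0 // mul1r.
by have := exprn_gt0 2 e0; clear; lra.
Qed.

Lemma re_min_lt e t : 0 < e -> (re_min e < re_min t) = (`|t| < e).
Proof.
move=> e0; rewrite /re_min ltr_pdivrMr ?onep_sqr_gt0 // mulrAC.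
rewrite ltr_pdivlMr ?onep_sqr_gt0 //.
have -> : ((1 - e ^+ 2) * (1 + t ^+ 2) < (1 - t ^+ 2) * (1 + e ^+ 2)) = (t ^+ 2 < e ^+ 2).
  by apply/idP/idP; clear; lra.
by rewrite -real_normK ?num_real // ltr_pXn2r ?nnegrE // ltW.
Qed.

Lemma cayley_onto p z e : 0 < e -> cabs p = 1 -> cabs z = 1 ->
  re_min e < re_coord p z -> exists2 t, `|t| < e & z = p * cayley t%:C.
Proof.
move=> e0 p1 z1; rewrite /re_coord; set u := conjc p * z.
have u1 : cabs u ^+ 2 = 1 by rewrite cabsM cabs_conjc p1 z1 mulr1 expr1n.
have zE : z = p * u.
  by rewrite /u mulrA -sqr_normc normcE_cabs p1 expr1n mul1r.
case: u u1 zE => a b; rewrite sqr_cabs /= => ab zE lta.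
(* The antipode of p, where the half-angle tangent b / (1 + a) has its pole, is excluded by
   [re_min e] > -1. *)
have a1 : 0 < 1 + a.
  have : -1 < re_min e.
    by rewrite /re_min ltr_pdivlMr ?onep_sqr_gt0 //; clear; lra.
  by move: lta; clear; lra.
have an0 : 1 + a != 0 by rewrite gt_eqF.
have bE : b ^+ 2 = (1 - a) * (1 + a) by move: ab; clear; lra.
pose t := b / (1 + a).
have t2 : t ^+ 2 = (1 - a) / (1 + a) by rewrite /t expr_div_n bE; field.
have tN : 1 - t ^+ 2 = 2 * a / (1 + a) by rewrite t2; field.
have tD : 1 + t ^+ 2 = 2 / (1 + a) by rewrite t2; field.
have tE : (1 - t ^+ 2) / (1 + t ^+ 2) = a by rewrite tN tD; field; rewrite an0.
exists t; first by rewrite -re_min_lt // /re_min tE.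
rewrite zE; congr (_ * _); apply/eqP.
rewrite eq_complex (cayley_sqr t).1 (cayley_sqr t).2 tE eqxx /=.
by apply/eqP; rewrite tD /t; field; rewrite an0.
Qed.

Lemma cayley_lipschitz (s t : R) : cabs (cayley s%:C - cayley t%:C) <= 2 * `|s - t|.
Proof.
have ds := cayley_denom_neq0 s; have dt := cayley_denom_neq0 t.
have ge1 (x : R) : 1 <= cabs (1 - 'i%C * x%:C).
  have := normr_Re_le (1 - 'i%C * x%:C).
  by have -> : complex.Re (1 - 'i%C * x%:C) = 1 by [rewrite /=; ring]; rewrite normr1.
have i2 : 'i%C * 'i%C = -1 :> R[i].
  by apply/eqP; rewrite eq_complex /=; apply/andP; split; apply/eqP; ring.
have -> : cayley s%:C - cayley t%:C =
    2 * 'i%C * (s - t)%:C / ((1 - 'i%C * s%:C) * (1 - 'i%C * t%:C)).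
  by rewrite /cayley rmorphB; field; rewrite ds dt.
rewrite cabsM cabsV !cabsM cabs_real.
have -> : cabs (2 : R[i]) = 2.
  by rewrite -(rmorph_nat (real_complex R)) cabs_real ger0_norm.
have -> : cabs ('i%C : R[i]) = 1.
  by apply/eqP; rewrite -(eqrXn2 (n := 2)) ?cabs_ge0 // sqr_cabs /= expr0n add0r.
rewrite mulr1 ler_piMr ?mulr_ge0 // invf_le1 ?mulr_ege1 //.
by rewrite mulr_gt0 // (lt_le_trans ltr01).
Qed.

(** The map is the simple root of (1 - i x) w - p (1 + i x), of degree 1 in w. *)
Lemma analytic_cayley p t : analytic_at (fun s : R => p * cayley s%:C) t.
Proof.
pose Q : {poly {poly R[i]}} :=
  (1 - 'i%C *: 'X)%:P * 'X - (p *: (1 + 'i%C *: 'X))%:P.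
have QE x : spec x Q = (1 - 'i%C * x) *: 'X - (p * (1 + 'i%C * x))%:P.
  rewrite /Q rmorphB rmorphM /= specX !specC !hornerZ !hornerD hornerN !hornerZ !hornerX.
  by rewrite !hornerC mul_polyC.
apply: (@analytic_simple_root R Q).
- move=> e e0; pose K := 2 * (cabs p + 1).
  have K0 : 0 < K by rewrite mulr_gt0 // ltr_wpDl ?cabs_ge0.
  exists (e / K) => [|s]; first by rewrite divr_gt0.
  rewrite ltr_pdivlMr // => lts; rewrite -mulrBr cabsM.
  have := ler_wpM2l (cabs_ge0 p) (cayley_lipschitz s t).
  by have := normr_ge0 (s - t); move: lts; rewrite /K; clear; nra.
- apply/near_normP; exists 1 => // s _; rewrite QE hornerD hornerN hornerZ hornerX hornerC /cayley.
  by have ds := cayley_denom_neq0 s; field.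
- rewrite QE derivB derivZ derivX derivC subr0 hornerZ hornerC mulr1.
  exact: cayley_denom_neq0.
Qed.

Lemma analytic_addl p (f : R -> R[i]) t :
  analytic_at f t -> analytic_at (fun s => p + f s) t.
Proof.
move=> [f1 f2]; split.
  by under eq_fun do rewrite ReD; apply: real_analytic_at_addl.
by under eq_fun do rewrite ImD; apply: real_analytic_at_addl.
Qed.

Lemma analytic_cst p t : analytic_at (fun=> p) t.
Proof.
have zero : real_analytic_at (fun=> 0 : R) t.
  exists (fun=> 0); apply/near_normP; exists 1 => // s _.
  have -> : pseries (fun=> 0) (s - t) = fun=> 0.
    by apply/funext => n; rewrite /pseries /series /= big1 // => i _; rewrite mul0r.
  exact: (cvg_cst (0 : R)).
have cst (c : R) : real_analytic_at (fun=> c) t.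
  apply: real_analytic_at_near (real_analytic_at_addl c zero).
  by apply/near_normP; exists 1 => // s _; rewrite addr0.
by split; apply: cst.
Qed.

(** The real and imaginary parts of [cayley] are 2 W - 1 and 2 s W with W = 1 / (1 + s^2). Their
    derivatives C' and S' at t satisfy S' - t C' = 2 W(t), so they are not both 0, and
    multiplication by p <> 0 preserves this. *)
Lemma cderive1_cayley p t : p != 0 -> cderive1 (fun s : R => p * cayley s%:C) t != 0.
Proof.
move=> p0; pose W (s : R) : R := (1 + s ^+ 2)^-1.
have W0 : W t != 0 by rewrite invr_eq0 gt_eqF ?onep_sqr_gt0.
have dX : is_derive t 1 (id : R -> R) 1 by exact: is_derive_id.
have d1 (c : R) : is_derive t 1 (cst c : R -> R) 0 by exact: is_derive_cst.
have dq : is_derive t 1 (fun s : R => 1 + s ^+ 2) (2 * t).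
  apply: is_derive_eq (is_deriveD (d1 1) (is_deriveM dX dX)) _.
  by rewrite add0r /GRing.scale /= mulr1 mulr2n mulrDl mul1r.
have dW : is_derive t 1 W (- (2 * t * W t ^+ 2)).
  apply: is_derive_eq (is_deriveV _ dq) _; first by rewrite gt_eqF ?onep_sqr_gt0.
  by rewrite /W exprVn /GRing.scale /= mulNr mulrC.
have dC : is_derive t 1 (fun s : R => complex.Re (cayley s%:C)) (2 * - (2 * t * W t ^+ 2)).
  have -> : (fun s : R => complex.Re (cayley s%:C)) = cst 2 * W - cst 1.
    apply/funext => s; rewrite (cayley_sqr s).1 /W !fctE.
    by field; rewrite gt_eqF ?onep_sqr_gt0.
  apply: is_derive_eq (is_deriveB (is_deriveM (d1 2) dW) (d1 1)) _.
  by rewrite /GRing.scale /= mulr0 addr0 subr0.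
have dS : is_derive t 1 (fun s : R => complex.Im (cayley s%:C))
    (2 * (W t + t * - (2 * t * W t ^+ 2))).
  have -> : (fun s : R => complex.Im (cayley s%:C)) = cst 2 * (id * W).
    by apply/funext => s; rewrite (cayley_sqr s).2 /W !fctE mulrA.
  apply: is_derive_eq (is_deriveM (d1 2) (is_deriveM dX dW)) _.
  by rewrite /GRing.scale /= mulr0 addr0 mulr1 [W t + _]addrC.
case: p p0 => a b p0.
have dRe : is_derive t 1 (fun s : R => complex.Re (Complex a b * cayley s%:C))
    (a * (2 * - (2 * t * W t ^+ 2)) - b * (2 * (W t + t * - (2 * t * W t ^+ 2)))).
  have -> : (fun s : R => complex.Re (Complex a b * cayley s%:C)) =
      cst a * (fun s : R => complex.Re (cayley s%:C)) - cst b * (fun s : R => complex.Im (cayley s%:C)).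
    by apply/funext => s; rewrite !fctE; case: (cayley _).
  apply: is_derive_eq (is_deriveB (is_deriveM (d1 a) dC) (is_deriveM (d1 b) dS)) _.
  by rewrite /GRing.scale /= !mulr0 !addr0.
have dIm : is_derive t 1 (fun s : R => complex.Im (Complex a b * cayley s%:C))
    (a * (2 * (W t + t * - (2 * t * W t ^+ 2))) + b * (2 * - (2 * t * W t ^+ 2))).
  have -> : (fun s : R => complex.Im (Complex a b * cayley s%:C)) =
      cst a * (fun s : R => complex.Im (cayley s%:C)) + cst b * (fun s : R => complex.Re (cayley s%:C)).
    by apply/funext => s; rewrite !fctE; case: (cayley _).
  apply: is_derive_eq (is_deriveD (is_deriveM (d1 a) dS) (is_deriveM (d1 b) dC)) _.
  by rewrite /GRing.scale /= !mulr0 !addr0.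
rewrite /cderive1 !derive1E (derive_val (is_derive := dRe)) (derive_val (is_derive := dIm)).
apply: contraNneq W0 => /eqP; rewrite eq_complex /= => /andP[/eqP E1 /eqP E2].
have ab : a ^+ 2 + b ^+ 2 != 0.
  by rewrite -(sqr_cabs (Complex a b)) expf_neq0 // cabs_eq0.
have C0 : 2 * - (2 * t * W t ^+ 2) = 0.
  apply: (mulfI ab); rewrite mulr0.
  have : a * 0 + b * 0 = 0 :> R by rewrite !mulr0 addr0.
  by rewrite -{1}E1 -E2 => <-; ring.
have S0 : 2 * (W t + t * - (2 * t * W t ^+ 2)) = 0.
  apply: (mulfI ab); rewrite mulr0.
  have : a * 0 - b * 0 = 0 :> R by rewrite !mulr0 subr0.
  by rewrite -{1}E2 -E1 => <-; ring.
apply/eqP; have : 2 * W t = 2 * (W t + t * - (2 * t * W t ^+ 2)) - t * (2 * - (2 * t * W t ^+ 2)) by ring.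
by rewrite C0 S0 mulr0 subr0 => /eqP; rewrite mulf_eq0 pnatr_eq0 /= => /eqP.
Qed.

End TorusCurves.

Section CurvesInTorus.
Variable R : realType.
Implicit Types (p : R[i]).

Lemma continuous_Re_mul (c : R[i]) : continuous (fun z : R[i]^o => complex.Re (c * z)).
Proof.
move=> z A /nbhs_ballP[e /= e0 eA].
have c0 : 0 < cabs c + 1 by rewrite ltr_wpDl ?cabs_ge0.
apply/nbhs_ballP; exists (e / (cabs c + 1))%:C; first by rewrite /= ltcR divr_gt0.
move=> y; rewrite /ball /= normcE_cabs ltcR => yz; apply: eA.
rewrite /ball /= -ReB -mulrBr (le_lt_trans (normr_Re_le _)) // cabsM.
rewrite ltr_pdivlMr // in yz; rewrite (le_lt_trans _ yz) // mulrC.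
by rewrite ler_wpM2l ?cabs_ge0 // lerDl.
Qed.

Lemma continuous_Im_mul (c : R[i]) : continuous (fun z : R[i]^o => complex.Im (c * z)).
Proof.
have -> : (fun z : R[i]^o => complex.Im (c * z)) = (fun z : R[i]^o => complex.Re (- 'i%C * c * z)).
  by apply/funext => z; case: c z => ? ? [? ?] /=; ring.
exact: continuous_Re_mul.
Qed.

Lemma continuous_tan_coord p (z : R[i]^o) : 1 + re_coord p z != 0 ->
  {for z, continuous (tan_coord p : R[i]^o -> R)}.
Proof.
move=> d0; have cI := @continuous_Im_mul (conjc p) z.
have cR := @continuous_Re_mul (conjc p) z.
exact: (cvgM cI (cvgV d0 (cvgD (cvg_cst (1 : R)) cR))).
Qed.

Lemma continuous_comp_fst (h : R[i]^o -> R) (z : C2 R) :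
  {for z.1, continuous h} -> {for z, continuous (fun y : C2 R => h y.1)}.
Proof.
have c1 : {for z, continuous (fst : C2 R -> R[i]^o)} by exact: cvg_fst.
exact: continuous_comp c1.
Qed.

Lemma continuous_comp_snd (h : R[i]^o -> R) (z : C2 R) :
  {for z.2, continuous h} -> {for z, continuous (fun y : C2 R => h y.2)}.
Proof.
have c1 : {for z, continuous (snd : C2 R -> R[i]^o)} by exact: cvg_snd.
exact: continuous_comp c1.
Qed.

(** An open set of C^2 that meets the torus in the points whose Cayley parameters relative to p are
    below e1 and e2 in modulus. *)
Definition torus_box (p : C2 R) (e1 e2 : R) : set (C2 R) :=
  [set z | re_min e1 < re_coord p.1 z.1 /\ re_min e2 < re_coord p.2 z.2].

Lemma open_torus_box (p : C2 R) e1 e2 : open (torus_box p e1 e2).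
Proof.
have -> : torus_box p e1 e2 =
    ((fun z : C2 R => re_coord p.1 z.1) @^-1` [set x | re_min e1 < x]) `&`
    ((fun z : C2 R => re_coord p.2 z.2) @^-1` [set x | re_min e2 < x]).
  by [].
apply: openI; apply: open_comp; try exact: open_gt; move=> z _.
  exact/continuous_comp_fst/continuous_Re_mul.
exact/continuous_comp_snd/continuous_Re_mul.
Qed.

Lemma torusP (z : C2 R) : torus z <-> cabs z.1 = 1 /\ cabs z.2 = 1.
Proof.
have norm1 (y : R[i]) : (`|y| = 1) <-> (cabs y = 1).
  rewrite normcE_cabs; split=> [/(congr1 (@complex.Re R))|->] //.
by rewrite /torus /=; split=> -[/norm1 ? /norm1 ?].
Qed.

(* The curve is parametrized by the Cayley parameter of one coordinate, of which
   the half-angle tangent of that coordinate is a continuous inverse. *)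
Lemma smooth_analytic_curve_of_cayley (i : bool) (p : C2 R) (gamma : R -> C2 R) (e : R) :
  let pr (z : C2 R) := if i then z.1 else z.2 in
  0 < e -> gamma 0 = p -> cabs (pr p) = 1 ->
  (forall t, `|t| < e -> torus (gamma t)) ->
  (forall t, pr (gamma t) = pr p * cayley t%:C) ->
  (forall t, `|t| < e -> analytic_at (fun s => (gamma s).1) t /\
                         analytic_at (fun s => (gamma s).2) t) ->
  smooth_analytic_curve p (gamma @` [set t | `|t| < e]).
Proof.
move=> pr e0 g0 p1 gT gpr an.
exists e, gamma, (fun z => tan_coord (pr p) (pr z)); split.
  by split=> // _ [t te <-]; apply: gT.
have p0 : pr p != 0 by rewrite -cabs_eq0 p1 oner_eq0.
split=> //.
- move=> t te; rewrite /pr in gpr p0.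
  case: i pr gpr p0 {p1} => /= pr gpr p0; [left|right].
    by rewrite (_ : (fun s => _) = (fun s => p.1 * cayley s%:C)) ?cderive1_cayley //; apply/funext.
  by rewrite (_ : (fun s => _) = (fun s => p.2 * cayley s%:C)) ?cderive1_cayley //; apply/funext.
- by move=> t te; rewrite gpr tan_coord_cayley.
- apply: continuous_in_subspaceT => z; rewrite inE => -[t te <-].
  have d0 : 1 + re_coord (pr p) (pr (gamma t)) != 0.
    rewrite gpr re_coord_cayley //.
    have q0 : 1 + t ^+ 2 != 0 by rewrite gt_eqF ?onep_sqr_gt0.
    have -> : 1 + (1 - t ^+ 2) / (1 + t ^+ 2) = 2 / (1 + t ^+ 2) by field.
    by rewrite mulf_neq0 ?invr_eq0 // pnatr_eq0.
  have ct := continuous_tan_coord d0.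
  move: (tan_coord (pr p)) ct => h ct.
  rewrite /pr in ct *; case: (i) ct => ct.
    exact: continuous_comp_fst ct.
  exact: continuous_comp_snd ct.
Qed.

Lemma small_near0 (fs : seq (R -> R[i])) (e : R) : 0 < e ->
  (forall f, f \in fs -> f 0 = 0 /\ ccontinuous_at f 0) ->
  exists2 d : R, 0 < d & forall f t, f \in fs -> `|t| < d -> cabs (f t) < e.
Proof.
move=> e0; elim: fs => [_|f fs IH fsP]; first by exists 1.
have [|d d0 Hd] := IH; first by move=> g gfs; apply: fsP; rewrite inE gfs orbT.
have [f0 ct] := fsP f (mem_head _ _); have [d' d'0 Hd'] := ct e e0.
exists (Num.min d d') => [|g t]; first by rewrite lt_min d0.
rewrite inE lt_min => /orP[/eqP ->|gfs] /andP[td td']; last exact: Hd.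
by have := Hd' t; rewrite f0 !subr0; apply.
Qed.

End CurvesInTorus.

Theorem corollary6p2 (R : realType) (V : set (C2 R)) :
  codistinguished_variety V ->
  forall p : C2 R, (V `&` @torus R) p ->
  exists U : set (C2 R), open_nbhs p U /\
  exists (N : nat) (S : 'I_N -> set (C2 R)),
    (forall i, smooth_analytic_curve p (S i)) /\
    V `&` @torus R `&` U = \bigcup_(i in [set: 'I_N]) S i.
Proof.
move=> [r [symr norootD ->]] p [rp /torusP[p1 p2]].
have [fs [e [e0 fsP rootP onV vert]]] := local_structure symr norootD p1 p2 rp.
(* The Cayley map is 2-Lipschitz, so a parameter below e / 2 keeps z2 within e of p2. *)
pose e2 := e / 2; have e20 : 0 < e2 by rewrite divr_gt0.
(* With |f(t)| < 1 - [re_min e2], the second coordinate p2 + f(t) stays in the box, so U contains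
   each arc entirely. *)
have eta0 : 0 < 1 - re_min e2 by rewrite subr_gt0 re_min_lt1.
have [|d d0 small] := small_near0 eta0 (fs := fs).
  by move=> f /fsP[f0 ct]; split=> //; apply: (ct 0 _).1; rewrite normr0.
pose e1 := Num.min e d; have e10 : 0 < e1 by rewrite lt_min e0.
have cayley0 : cayley (0%:C : R[i]) = 1 by rewrite /cayley mulr0 addr0 subr0 divr1.
have self (q : R[i]) : cabs q = 1 -> re_coord q q = 1.
  move=> q1; have := @re_coord_cayley R q 0 q1.
  by rewrite cayley0 mulr1 expr0n subr0 addr0 divr1.
have pbox : torus_box p e1 e2 p by split; rewrite self ?re_min_lt1.
pose gam f (t : R) : C2 R := (p.1 * cayley t%:C, p.2 + f t).
pose ver (t : R) : C2 R := (p.1, p.2 * cayley t%:C).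
have gam0 f : f \in fs -> gam f 0 = p.
  by move=> /fsP[f0 _]; rewrite /gam cayley0 mulr1 f0 addr0 -surjective_pairing.
have ver0 : ver 0 = p by rewrite /ver cayley0 mulr1 -surjective_pairing.
have gamP f t : f \in fs -> `|t| < e1 -> (zero_set r `&` @torus R) (gam f t).
  move=> ffs; rewrite lt_min => /andP[te td].
  have [->|t0] := eqVneq t 0; first by rewrite gam0 //; split=> //; apply/torusP.
  have [rt ct] := onV t f t0 te ffs; split=> //.
  by apply/torusP; rewrite /= cabsM p1 cabs_cayley mulr1.
pose curves : seq (set (C2 R)) :=
  [seq gam f @` [set t | `|t| < e1] | f <- fs] ++
  (if r.[p.1%:P] == 0 then [:: ver @` [set t | `|t| < e2]] else [::]).
exists (torus_box p e1 e2); split; first by split => //; exact: open_torus_box.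
exists (size curves), (tnth (in_tuple curves)); split.
- move=> i; have := mem_tnth i (in_tuple curves); move: (tnth _ i) => A.
  rewrite mem_cat => /orP[/mapP[f ffs ->]|].
    apply: (@smooth_analytic_curve_of_cayley R true) => //; first exact: gam0.
      by move=> t te; have [] := gamP f t ffs te.
    move=> t; rewrite lt_min => /andP[te _]; split; first exact: analytic_cayley.
    by apply: analytic_addl; have [_ /(_ t te)[]] := fsP f ffs.
  case: eqP => // r0; rewrite inE => /eqP ->.
  apply: (@smooth_analytic_curve_of_cayley R false) => //.
    by move=> t _; apply/torusP; rewrite /= p1 cabsM p2 cabs_cayley mulr1.
  by move=> t _; split; [exact: analytic_cst | exact: analytic_cayley].
have -> : \bigcup_(i in [set: 'I_(size curves)]) tnth (in_tuple curves) i =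
    [set z | exists2 A, A \in curves & A z].
  apply/seteqP; split=> z /=.
    by move=> [i _ Az]; exists (tnth (in_tuple curves) i); rewrite ?mem_tnth.
  by move=> [A /(tnthP (in_tuple curves))[i ->] Az]; exists i.
apply/seteqP; split=> z /=.
- move=> [[rz /torusP[z1 z2]] [box1 box2]].
  have [t te z1E] := cayley_onto e10 p1 z1 box1.
  have [s se z2E] := cayley_onto e20 p2 z2 box2.
  have w2 : cabs (z.2 - p.2) < e.
    have := cayley_lipschitz s 0; rewrite subr0 cayley0 => le_s.
    rewrite z2E -{2}[p.2]mulr1 -mulrBr cabsM p2 mul1r (le_lt_trans le_s) //.
    by rewrite mulrC -ltr_pdivlMr.
  have zE2 : z.2 = p.2 + (z.2 - p.2) by rewrite subrKC.
  have te' : `|t| < e by move: te; rewrite lt_min => /andP[].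
  have inS f : f \in fs -> z.2 - p.2 = f t ->
      exists2 A, A \in curves & A z.
    move=> ffs wf; exists (gam f @` [set t | `|t| < e1]).
      by rewrite mem_cat (map_f (fun f => gam f @` _) ffs).
    by exists t => //; rewrite /gam -z1E -wf -zE2 -surjective_pairing.
  (* Off the slice z1 = p1 the branches account for z; on it the alternative [vert] decides. *)
  have [t0|t0] := eqVneq t 0; last first.
    have [|f ffs wf] := rootP t (z.2 - p.2) t0 te' w2; last exact: (inS f).
    by rewrite -zE2 -z1E.
  have z1p : z.1 = p.1 by rewrite z1E t0 cayley0 mulr1.
  have [r0|[fs0 isol]] := vert.
    exists (ver @` [set t | `|t| < e2]); first by rewrite mem_cat r0 eqxx mem_head orbT.
    by exists s => //; rewrite /ver -z2E -z1p -surjective_pairing.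
  have w0 : z.2 - p.2 = 0 by apply: isol => //; rewrite -zE2 -z1p.
  (* Here z = p, through which every branch passes at t = 0. *)
  case: (fs) fs0 fsP inS => // f fs' _ fsP' inS; apply: (inS f); rewrite ?mem_head //.
  by rewrite t0 (fsP' f (mem_head _ _)).1.
- move=> [A]; rewrite mem_cat => /orP[/mapP[f ffs ->] [t te <-]|].
    split; first exact: gamP.
    split; rewrite /=; first by rewrite re_coord_cayley // re_min_lt.
    have -> : re_coord p.2 (p.2 + f t) = re_coord p.2 p.2 + re_coord p.2 (f t).
      by rewrite /re_coord mulrDr ReD.
    have ft : cabs (f t) < 1 - re_min e2.
      by apply: small => //; move: te; rewrite /= lt_min => /andP[].
    have := normr_Re_le (conjc p.2 * f t); rewrite cabsM cabs_conjc p2 mul1r.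
    by rewrite self // -/(re_coord p.2 (f t)) ler_norml => /andP[]; clear - ft; lra.
  case: eqP => // r0; rewrite inE => /eqP -> [t te <-]; split.
    split; first by rewrite /zero_set /= r0 horner0.
    by apply/torusP; rewrite /= p1 cabsM p2 cabs_cayley mulr1.
  split; first exact: pbox.1.
  by rewrite /= re_coord_cayley // re_min_lt.
Qed.
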